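(* Let $(\mathbf M,\circ)$ be one of the semigroups $(\mathcal M,\boxplus)$, $(\mathcal M_+,\boxtimes)$, $(\mathcal M_*,\boxtimes)$. Every probability measure $\mu\in\mathbf M$ which is not a Dirac measure and whose support consists of a finite number of points is indecomposable in $(\mathbf M,\circ)$.
   Context: Notation: $\mathbb C^+$ is the open upper half-plane, $\mathbb R_+=[0,\infty)$, $\mathbb D$ the open unit disk, $\mathbb T$ the unit circle, $\mathcal N$ the class of analytic $f:\mathbb C^+\to\mathbb C^+\cup\mathbb R$, $\delta_a$ the Dirac measure at $a$. $(\mathbf M,\circ)$ is one of three commutative semigroups: (i) $(\mathcal M,\boxplus)$: $\mathcal M$ is the set of Borel probability measures on $\mathbb R$. For $\mu\in\mathcal M$, $F_\mu(z)=\big(\int_{\mathbb R}\frac{\mu(dt)}{z-t}\big)^{-1}$, $z\in\mathbb C^+$, and $\mathcal F=\{F_\mu:\mu\in\mathcal M\}$. Given $\mu_1,\mu_2$ there are unique $Z_1,Z_2\in\mathcal F$ with $z=Z_1(z)+Z_2(z)-F_{\mu_1}(Z_1(z))$, $F_{\mu_1}(Z_1(z))=F_{\mu_2}(Z_2(z))$ on $\mathbb C^+$; $\mu_1\boxplus\mu_2$ is the measure in $\mathcal M$ with $F_{\mu_1\boxplus\mu_2}(z)=F_{\mu_1}(Z_1(z))$ (free additive convolution). (ii) $(\mathcal M_+,\boxtimes)$: $\mathcal M_+$ is the set of Borel probability measures on $\mathbb R_+$ with $\mu(\{0\})<1$; $\psi_\mu(z)=\int_{\mathbb R_+}\frac{z\xi}{1-z\xi}\mu(d\xi)$,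 $K_\mu=\psi_\mu/(1+\psi_\mu)$ on $\mathbb C\setminus\mathbb R_+$; $\mathcal K$ is the class of $f\in\mathcal N$ analytic and nonpositive on $(-\infty,0)$ with $f(-x)\to0$ as $x\downarrow0$. Given $\mu_1,\mu_2$ there are unique $Z_1,Z_2\in\mathcal K$ (not identically zero) with $Z_1(z)Z_2(z)=zK_{\mu_1}(Z_1(z))$, $K_{\mu_1}(Z_1(z))=K_{\mu_2}(Z_2(z))$ on $\mathbb C^+$; $\mu_1\boxtimes\mu_2$ is the measure in $\mathcal M_+$ with $K_{\mu_1\boxtimes\mu_2}(z)=K_{\mu_1}(Z_1(z))$ (free multiplicative convolution). (iii) $(\mathcal M_*,\boxtimes)$: $\mathcal M_*$ is the set of Borel probability measures on $\mathbb T$ with $\int_{\mathbb T}\xi\,\mu(d\xi)\ne0$; $\psi_\mu(z)=\int_{\mathbb T}\frac{z\xi}{1-z\xi}\mu(d\xi)$, $Q_\mu=\psi_\mu/(1+\psi_\mu)$ on $\mathbb D$; $\mathcal S_*$ is the class of analytic $Q:\mathbb D\to\overline{\mathbb D}$ with $Q(0)=0$, $Q'(0)\ne0$. Given $\mu_1,\mu_2$ there are unique $Z_1,Z_2\in\mathcal S_*$ with $Z_1(z)Z_2(z)=zQ_{\mu_1}(Z_1(z))$, $Q_{\mu_1}(Z_1(z))=Q_{\mu_2}(Z_2(z))$ on $\mathbb D$; $\mu_1\boxtimes\mu_2$ is the measure in $\mathcal M_*$ with $Q_{\mu_1\boxtimes\mu_2}(z)=Q_{\mu_1}(Z_1(z))$.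 Arithmetic: $\mu_1\in\mathbf M$ is a factor of $\mu\in\mathbf M$ if $\mu=\mu_1\circ\mu_2$ for some $\mu_2\in\mathbf M$. The Dirac measures in $\mathbf M$ are $\delta_a$ with $a\in\mathbb R$, $a>0$, $a\in\mathbb T$, respectively. The improper factors of $\mu$ are the measures $\delta_a$ and $\mu\circ\delta_b$, with $a,b$ in the respective range. $\mu$ is indecomposable if it is not a Dirac measure and has improper factors only. *)

(* Defs.v *)
From HB Require Import structures.
From mathcomp Require Import all_boot all_order all_algebra.
From mathcomp Require Import all_classical all_reals all_analysis.
From mathcomp Require Import complex.
Set Implicit Arguments.
Unset Strict Implicit.
Unset Printing Implicit Defensive.
Import Order.TTheory GRing.Theory Num.Theory.
Import numFieldNormedType.Exports.
Local Open Scope classical_set_scope.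
Local Open Scope ring_scope.
Local Open Scope complex_scope.

(* The complex numbers with the structure of a normed space over themselves,
   so that [derivable f z 1] is complex differentiability. *)
Notation Cplx R := (R[i]^o).

Notation BorelC R := (g_sigma_algebraType (@open (Cplx R))).

Definition upper_half_plane (R : realType) : set (Cplx R) :=
  [set z | 0 < complex.Im z].

Definition unit_disk (R : realType) : set (Cplx R) := [set z | `|z| < 1].

Definition unit_circle (R : realType) : set (Cplx R) := [set z | `|z| = 1].

(* On a set which is not open, analyticity means analyticity on some open
   neighbourhood of the set. *)
Definition analytic_on (R : realType) (A : set (Cplx R))
    (f : Cplx R -> Cplx R) : Prop :=
  forall z, A z -> \forall w \near z, derivable f w 1.

Definition Cintegral (d : measure_display) (T : measurableType d)
    (R : realType) (mu : {measure set T -> \bar R}) (D : set T)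
    (f : T -> Cplx R) : Cplx R :=
  (\int[mu]_(x in D) complex.Re (f x)) +i* (\int[mu]_(x in D) complex.Im (f x)).

(* The values of a measure on non-measurable sets are unspecified, so equality
   of measures is equality on measurable sets and not Leibniz equality. *)
Definition same_measure (d : measure_display) (T : measurableType d)
    (R : realType) (mu nu : probability T R) : Prop :=
  forall A : set T, measurable A -> mu A = nu A.

Definition msupport (T : topologicalType) (R : realType)
    (mu : set T -> \bar R) : set T :=
  [set x | forall U : set T, open U -> U x -> (0 < mu U)%E].

(* A commutative semigroup of probability measures is given by its carrier [M],
   the graph [op] of its operation ([op mu1 mu2 mu] means that [mu] is the
   composition of [mu1] and [mu2]) and the set [D] of the points [a] such that
   the Dirac measure at [a] is in [M].  A graph is used because the free
   convolutions are characterized by subordination functions, whose existence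
   and uniqueness are theorems. *)

Definition is_dirac (d : measure_display) (T : measurableType d)
    (R : realType) (D : set T) (mu : probability T R) : Prop :=
  exists2 a, D a & same_measure mu (\d_a : probability T R).

Definition is_factor (d : measure_display) (T : measurableType d)
    (R : realType) (M : set (probability T R))
    (op : probability T R -> probability T R -> probability T R -> Prop)
    (mu mu1 : probability T R) : Prop :=
  M mu1 /\ exists2 mu2, M mu2 & op mu1 mu2 mu.

Definition is_improper_factor (d : measure_display) (T : measurableType d)
    (R : realType)
    (op : probability T R -> probability T R -> probability T R -> Prop)
    (D : set T) (mu nu : probability T R) : Prop :=
  is_dirac D nu \/ exists2 b, D b & op mu (\d_b : probability T R) nu.

Definition indecomposable (d : measure_display) (T : measurableType d)
    (R : realType) (M : set (probability T R))
    (op : probability T R -> probability T R -> probability T R -> Prop)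
    (D : set T) (mu : probability T R) : Prop :=
  ~ is_dirac D mu /\
  forall nu, is_factor M op mu nu -> is_improper_factor op D mu nu.

Definition F_transform (R : realType)
    (mu : probability R R) (z : Cplx R) : Cplx R :=
  (Cintegral mu setT (fun t : R => (z - t%:C)^-1))^-1.

Definition class_F (R : realType) (Z : Cplx R -> Cplx R) : Prop :=
  exists mu : probability R R,
    forall z, upper_half_plane z -> Z z = F_transform mu z.

Definition free_add (R : realType)
    (mu1 mu2 mu : probability R R) : Prop :=
  exists Z1 Z2 : Cplx R -> Cplx R,
    [/\ class_F Z1, class_F Z2 &
      forall z, upper_half_plane z ->
        [/\ z = Z1 z + Z2 z - F_transform mu1 (Z1 z),
            F_transform mu1 (Z1 z) = F_transform mu2 (Z2 z) &
            F_transform mu z = F_transform mu1 (Z1 z)]].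

(* Measures on [0, +oo) are measures on the real line carried by [0, +oo). *)
Definition M_plus (R : realType) (mu : probability R R) :
    Prop :=
  mu [set x : R | 0 <= x] = 1%E /\ (mu [set 0%R : R] < 1)%E.

Definition psi_plus (R : realType)
    (mu : probability R R) (z : Cplx R) : Cplx R :=
  Cintegral mu [set x : R | 0 <= x]
    (fun xi : R => z * xi%:C / (1 - z * xi%:C)).

Definition K_transform (R : realType)
    (mu : probability R R) (z : Cplx R) : Cplx R :=
  psi_plus mu z / (1 + psi_plus mu z).

Definition class_N (R : realType) (f : Cplx R -> Cplx R) : Prop :=
  analytic_on (@upper_half_plane R) f /\
  forall z, upper_half_plane z -> 0 <= complex.Im (f z).

(* In [R[i]], [w <= 0] means that [w] is real and nonpositive. *)
Definition class_K (R : realType) (f : Cplx R -> Cplx R) : Prop :=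
  [/\ class_N f,
      analytic_on [set x%:C | x in [set x : R | x < 0]] f,
      forall x : R, x < 0 -> f x%:C <= 0 &
      f (- x)%:C @[x --> (0 : R)^'+] --> (0 : Cplx R)].

Definition free_mul_plus (R : realType)
    (mu1 mu2 mu : probability R R) : Prop :=
  M_plus mu /\
  exists Z1 Z2 : Cplx R -> Cplx R,
    [/\ class_K Z1 /\ (exists2 z, upper_half_plane z & Z1 z != 0),
        class_K Z2 /\ (exists2 z, upper_half_plane z & Z2 z != 0) &
      forall z, upper_half_plane z ->
        [/\ Z1 z * Z2 z = z * K_transform mu1 (Z1 z),
            K_transform mu1 (Z1 z) = K_transform mu2 (Z2 z) &
            K_transform mu z = K_transform mu1 (Z1 z)]].

(* Measures on the unit circle are Borel measures on the complex plane carried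
   by the unit circle. *)
Definition M_star (R : realType) (mu : probability (BorelC R) R) : Prop :=
  mu (@unit_circle R) = 1%E /\
  Cintegral mu (@unit_circle R) (fun xi : BorelC R => xi) != 0.

Definition psi_star (R : realType) (mu : probability (BorelC R) R)
    (z : Cplx R) : Cplx R :=
  Cintegral mu (@unit_circle R)
    (fun xi : BorelC R => z * (xi : Cplx R) / (1 - z * (xi : Cplx R))).

Definition Q_transform (R : realType) (mu : probability (BorelC R) R)
    (z : Cplx R) : Cplx R :=
  psi_star mu z / (1 + psi_star mu z).

Definition class_S_star (R : realType) (Q : Cplx R -> Cplx R) : Prop :=
  [/\ analytic_on (@unit_disk R) Q,
      forall z, unit_disk z -> `|Q z| <= 1,
      Q 0 = 0 &
      'D_1 Q 0 != 0].

Definition free_mul_star (R : realType)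
    (mu1 mu2 mu : probability (BorelC R) R) : Prop :=
  M_star mu /\
  exists Z1 Z2 : Cplx R -> Cplx R,
    [/\ class_S_star Z1, class_S_star Z2 &
      forall z, unit_disk z ->
        [/\ Z1 z * Z2 z = z * Q_transform mu1 (Z1 z),
            Q_transform mu1 (Z1 z) = Q_transform mu2 (Z2 z) &
            Q_transform mu z = Q_transform mu1 (Z1 z)]].

(* Main.v *)
From HB Require Import structures.
Require Import Defs.
From mathcomp Require Import all_boot all_order all_algebra.
From mathcomp Require Import all_classical all_reals all_analysis.
From mathcomp Require Import complex ring lra measurable_realfun.
Import Order.TTheory GRing.Theory Num.Theory.
Import numFieldNormedType.Exports.
Local Open Scope classical_set_scope.
Local Open Scope ring_scope.
Local Open Scope complex_scope.
Set Implicit Arguments.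
Unset Strict Implicit.
Unset Printing Implicit Defensive.
Import ComplexField.Normc.

(** Let [mu] be the composition of [mu1] and [mu2].  The proof looks at the atoms.

    Let [S] denote the integral of the kernel [1 / (z - t)] in the additive case and
    of [1 / (1 - z t)], that is [1 + psi], in the multiplicative cases.  The three
    transforms are [F = 1 / S], [K = 1 - 1 / S] and [Q = 1 - 1 / S].  An atom [c] of
    [mu] shows up as a residue: [(z - c) S], respectively [(1 - z c) S], tends to
    [mu {c}] when [z] approaches the boundary point [c], respectively [1 / c],
    nontangentially.  Subordination says that the same [S] is the integral of the
    kernel for [mu1] at [Z1 z] and for [mu2] at [Z2 z].  Jensen's inequality for the
    transforms shows that [Z1 z] and [Z2 z] are no closer to the boundary than [z],
    while [S] grows like the inverse of the distance of [z] to the boundary.  By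
    dominated convergence this is only possible if, along a subsequence, [Z1 z] and
    [Z2 z] approach atoms [a] of [mu1] and [b] of [mu2] nontangentially
    ([subordination_at_atom]).  The first-order terms of the subordination equation
    give [a + b = c], respectively [a b = c], and

      [mu1 {a} + mu2 {b} = mu {c} + 1]

    ([free_add_atoms], [mul_plus_atoms], [mul_star_atoms]).

    The pairs [(a, b)] of two different atoms of [mu] have a common component, as the
    four masses would otherwise sum up to more than 2; hence all pairs have a common
    component, say [a].  When [mu] consists of [n] atoms, summation over them gives
    [n (mu1 {a} - 1) + \sum_b mu2 {b} = 1], which forces [mu1 {a} = 1]
    ([unit_weight_of_atom_sums]).  On the half-line the atom at 0 is treated apart:
    looking at infinity instead of at a boundary point shows that [mu {0}] is
    [mu1 {0}] or [mu2 {0}] ([mul_plus_atom0]).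

    So [mu1] or [mu2] is a Dirac measure.  In the first case [mu1] is an improper
    factor.  In the second one [mu1] is the composition of [mu] and the inverse Dirac
    measure, with explicit subordination functions, and it remains to see that these
    lie in the required class.  In the multiplicative cases they are rescalings of the
    given ones.  In the additive case [F_mu - b] has to be an F-transform for real
    [b]: since [mu] has finitely many atoms, it is that of the spectral measure of a
    rank-one perturbation of a diagonal matrix ([rank_one_perturbation]). *)

(** * Complex numbers and their limits *)

Notation CRe := complex.Re.
Notation CIm := complex.Im.

Lemma CReD (R : realType) (x y : R[i]) : CRe (x + y) = CRe x + CRe y.
Proof. by case: x y => a b [c d]. Qed.
Lemma CImD (R : realType) (x y : R[i]) : CIm (x + y) = CIm x + CIm y.
Proof. by case: x y => a b [c d]. Qed.
Lemma CReN (R : realType) (x : R[i]) : CRe (- x) = - CRe x.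
Proof. by case: x. Qed.
Lemma CImN (R : realType) (x : R[i]) : CIm (- x) = - CIm x.
Proof. by case: x. Qed.
Lemma CReM (R : realType) (x y : R[i]) :
  CRe (x * y) = CRe x * CRe y - CIm x * CIm y.
Proof. by case: x y => a b [c d]. Qed.
Lemma CImM (R : realType) (x y : R[i]) :
  CIm (x * y) = CRe x * CIm y + CIm x * CRe y.
Proof. by case: x y => a b [c d]. Qed.
Lemma CReV (R : realType) (x : R[i]) :
  CRe x^-1 = CRe x / (CRe x ^+ 2 + CIm x ^+ 2).
Proof. by case: x. Qed.
Lemma CImV (R : realType) (x : R[i]) :
  CIm x^-1 = - CIm x / (CRe x ^+ 2 + CIm x ^+ 2).
Proof. by case: x => a b /=; rewrite mulNr. Qed.
Definition ReImE := (CReD, CImD, CReN, CImN, CReM, CImM, CReV, CImV).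

Lemma complex_eqP (R : realType) (x y : R[i]) :
  CRe x = CRe y -> CIm x = CIm y -> x = y.
Proof. by case: x y => a b [c d] /= -> ->. Qed.

Lemma sqr_normcE (R : realType) (x : R[i]) :
  normc x ^+ 2 = CRe x ^+ 2 + CIm x ^+ 2.
Proof. by case: x => a b; rewrite /= sqr_sqrtr // addr_ge0 ?sqr_ge0. Qed.

Lemma normr_normc (R : realType) (x : R[i]) : `|x| = (normc x)%:C.
Proof. by case: x. Qed.

Lemma normc_ge0 (R : realType) (x : R[i]) : 0 <= normc x.
Proof. by case: x => a b; rewrite sqrtr_ge0. Qed.

Lemma normc_gt0 (R : realType) (x : R[i]) : (0 < normc x) = (x != 0).
Proof.
rewrite lt_neqAle normc_ge0 andbT eq_sym; congr (~~ _).
by apply/eqP/eqP => [/eq0_normc //|->]; rewrite normc0.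
Qed.

Lemma normc_real (R : realType) (x : R) : normc x%:C = `|x|.
Proof. by rewrite /= expr0n addr0 sqrtr_sqr. Qed.

Lemma normc_geRe (R : realType) (x : R[i]) : `|CRe x| <= normc x.
Proof.
case: x => a b /=; rewrite -sqrtr_sqr ler_sqrt ?addr_ge0 ?sqr_ge0//.
by rewrite lerDl sqr_ge0.
Qed.

Lemma normc_geIm (R : realType) (x : R[i]) : `|CIm x| <= normc x.
Proof.
case: x => a b /=; rewrite -sqrtr_sqr ler_sqrt ?addr_ge0 ?sqr_ge0//.
by rewrite lerDr sqr_ge0.
Qed.

Lemma normc_le_ReIm (R : realType) (x : R[i]) :
  normc x <= `|CRe x| + `|CIm x|.
Proof.
have h0 : 0 <= `|CRe x| + `|CIm x| by rewrite addr_ge0.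
rewrite -(@ler_pXn2r _ 2)// ?nnegrE ?normc_ge0// sqr_normcE sqrrD !real_normK ?num_real//.
by have := mulr_ge0 (normr_ge0 (CRe x)) (normr_ge0 (CIm x)); lra.
Qed.

Lemma le_normcB (R : realType) (x y : R[i]) : normc x - normc y <= normc (x + y).
Proof.
have := @le_normcD R (x + y) (- y).
by rewrite addrK normcN lerBlDr.
Qed.

Section CvgC.
Context (R : realType) (T : Type) (F : set_system T) {FF : Filter F}.

Lemma cvgC_normc (f : T -> Cplx R) (l : Cplx R) :
  f @ F --> l <-> normc (l - f x) @[x --> F] --> (0 : R).
Proof.
split => [/cvgrPdist_lt h|/cvgrPdist_lt h].
  apply/cvgrPdist_lt => e e0; have e0' : (0 : R[i]) < e%:C by rewrite ltcR.
  near=> x; rewrite sub0r normrN ger0_norm ?normc_ge0// -ltcR -normr_normc.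
  by near: x; exact: h.
apply/cvgrPdist_lt => e; rewrite ltcE /= => /andP[/eqP ei e0].
near=> x; rewrite (_ : e = (CRe e)%:C); last by apply: complex_eqP; rewrite /= ?ei.
rewrite normr_normc ltcR -[ltLHS]ger0_norm ?normc_ge0// -normrN -[ltLHS]/(`|_|) -sub0r.
by near: x; exact: h.
Unshelve. all: by end_near. Qed.

Lemma cvgC_ReIm (f : T -> Cplx R) (l : Cplx R) :
  f @ F --> l <-> CRe (f x) @[x --> F] --> CRe l /\ CIm (f x) @[x --> F] --> CIm l.
Proof.
rewrite cvgC_normc; split => [h|[/cvgrPdist_lt h1 /cvgrPdist_lt h2]].
  split; apply/cvgrPdist_lt => e e0; near=> x.
    rewrite -CReN -CReD (le_lt_trans (normc_geRe _))//.
    rewrite -[ltLHS]ger0_norm ?normc_ge0// -normrN -sub0r.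
    by near: x; move: h => /cvgrPdist_lt; exact.
  rewrite -CImN -CImD (le_lt_trans (normc_geIm _))//.
  rewrite -[ltLHS]ger0_norm ?normc_ge0// -normrN -sub0r.
  by near: x; move: h => /cvgrPdist_lt; exact.
apply/cvgrPdist_lt => e e0; near=> x.
rewrite sub0r normrN ger0_norm ?normc_ge0// (le_lt_trans (normc_le_ReIm _))// (splitr e).
rewrite ltrD// !ReImE; near: x; [apply: h1|apply: h2]; exact: divr_gt0.
Unshelve. all: by end_near. Qed.

Lemma cvgC0 (f : T -> Cplx R) :
  f @ F --> (0 : Cplx R) <-> normc (f x) @[x --> F] --> (0 : R).
Proof.
rewrite cvgC_normc; under eq_fun do rewrite sub0r normcN.
by [].
Qed.

Lemma cvgC_real (f : T -> R) (l : R) :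
  f @ F --> l -> ((f x)%:C : Cplx R) @[x --> F] --> (l%:C : Cplx R).
Proof. by move=> h; apply/cvgC_ReIm; split => //=; exact: cvg_cst. Qed.

End CvgC.

Lemma cvgC_cst_eq (R : realType) (f : nat -> Cplx R) (x l : Cplx R) :
  f @ \oo --> l -> (forall k, f k = x) -> x = l.
Proof.
move=> fl fx; apply: (cvg_unique (@norm_hausdorff _ (Cplx R))) fl.
rewrite (_ : f = fun=> x); last exact/funext.
exact: cvg_cst.
Qed.

Lemma cvgCC (R : realType) (x : Cplx R) : (fun _ : nat => x) @ \oo --> x.
Proof. exact: cvg_cst. Qed.
Arguments cvgCC {R} x.

(** The usual rules with the operations applied to values: the limits below chain
    several of them, and the terms of the resulting sequence are to be rewritten. *)
Section PointwiseLimits.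
Context (R : realType) (f g : nat -> Cplx R) (a b : Cplx R).
Hypotheses (fa : f @ \oo --> a) (gb : g @ \oo --> b).

Lemma cvgCD : (f k + g k : Cplx R) @[k --> \oo] --> a + b.
Proof. exact: (cvgD fa gb). Qed.

Lemma cvgCB : (f k - g k : Cplx R) @[k --> \oo] --> a - b.
Proof. exact: (cvgB fa gb). Qed.

Lemma cvgCM : (f k * g k : Cplx R) @[k --> \oo] --> a * b.
Proof. exact: (cvgM fa gb). Qed.

Lemma cvgCV : a != 0 -> ((f k)^-1 : Cplx R) @[k --> \oo] --> a^-1.
Proof. by move=> a0; exact: (cvgV a0 fa). Qed.

End PointwiseLimits.

(** * Integrals of bounded complex functions *)

Section Meas.
Context d (T : measurableType d) (R : realType) (mu : probability T R).
Variable D : set T.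
Hypothesis mD : measurable D.

Lemma bounded_integrable (f : T -> R) (M : R) : measurable_fun D f ->
  (forall x, D x -> `|f x| <= M) -> mu.-integrable D (EFin \o f).
Proof.
move=> mf fM; apply: measurable_bounded_integrable => //.
  by rewrite (le_lt_trans (probability_le1 mu mD)) ?ltry.
exists M; split; first exact: num_real.
by move=> x Mx y Dy /=; rewrite (le_trans (fM _ Dy))// ltW.
Qed.

Lemma Rintegral_bounded_cvg (f_ : nat -> T -> R) (f : T -> R) (M : R) :
  (forall n, measurable_fun D (f_ n)) -> measurable_fun D f ->
  (forall n x, D x -> `|f_ n x| <= M) ->
  (forall x, D x -> f_ n x @[n --> \oo] --> f x) ->
  \int[mu]_(x in D) f_ n x @[n --> \oo] --> \int[mu]_(x in D) f x.
Proof.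
move=> mf_ mf fM fcvg.
have fM' x : D x -> `|f x| <= M.
  move=> Dx; have /cvg_norm h := fcvg _ Dx.
  by apply: (closed_cvg (fun y => y <= M) (@closed_le _ M)) h; apply: nearW => n; exact: fM.
have h1 : {ae mu, forall x, D x ->
    (fun n => EFin \o f_ n) ^~ x @ \oo --> (EFin \o f) x}.
  apply: aeW => x Dx; apply/fine_cvgP; split; first exact: nearW.
  exact: fcvg.
have h2 : {ae mu, forall x n, D x ->
    (`|(fun n => EFin \o f_ n) n x| <= (EFin \o cst M) x)%E}.
  by apply: aeW => x n Dx /=; rewrite lee_fin fM.
have [_ _ h] := dominated_convergence mD
  (fun n => (measurable_realfun.measurable_EFinP D (f_ n)).2 (mf_ n))
  ((measurable_realfun.measurable_EFinP D f).2 mf) h1 (finite_measure_integrable_cst mu M mD) h2.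
apply: fine_cvg.
rewrite fineK; last by apply: integrable_fin_num => //; apply: bounded_integrable fM'.
exact: h.
Qed.

(** A nonnegative function with zero integral vanishes almost everywhere. *)
Lemma Rintegral_gt0 (f : T -> R) (M : R) : measurable_fun D f ->
  (forall x, D x -> `|f x| <= M) -> (forall x, D x -> 0 <= f x) ->
  mu D = 1%E -> (mu [set x | D x /\ f x = 0%R] < 1)%E ->
  0 < \int[mu]_(x in D) f x.
Proof.
move=> mf fM f0 D1 fn0; have i0 := Rintegral_ge0 mu f0.
rewrite lt_neqAle i0 andbT; apply/negP => /eqP/esym ie.
have fi := bounded_integrable mf fM.
have m0 : measurable [set x | D x /\ f x = 0%R].
  by apply: (mf mD [set 0]); exact: measurable_set1.
have mfE : measurable_fun D (EFin \o f) by apply/measurable_EFinP.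
have : (\int[mu]_(x in D) `|(EFin \o f) x| = 0)%E.
  rewrite (eq_integral (EFin \o f)); last first.
    by move=> x; rewrite inE => Dx; rewrite gee0_abs// lee_fin f0.
  by rewrite -[LHS]fineK ?integrable_fin_num//; congr (_%:E).
move/(ae_eq_integral_abs mu mD mfE) => [N [mN N0 sN]].
suff : (1 <= mu [set x | D x /\ f x = 0%R])%E by rewrite leNgt fn0.
have DN0 : mu (D `&` N) = 0%E.
  by apply/eqP; rewrite -measure_le0 -N0 le_measure ?inE//; exact: measurableI.
have eD : (mu D <= mu (D `\` N) + mu (D `&` N))%E.
  rewrite -{1}(setUIDK D N) setUC; apply: measureU2; [exact: measurableD|exact: measurableI].
rewrite -D1 (le_trans eD)// DN0 adde0 le_measure ?inE//; first exact: measurableD.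
move=> x [Dx Nx]; split => //; apply: contrapT => fx; apply: Nx; apply: sN => /= h.
by apply: fx; have [] := h Dx.
Qed.

Definition bounded_measurable (g : T -> R[i]) : Prop :=
  [/\ measurable_fun D (fun x => CRe (g x)), measurable_fun D (fun x => CIm (g x)) &
   exists M : R, forall x, D x -> normc (g x) <= M].

Lemma bounded_measurable_intRe g : bounded_measurable g ->
  mu.-integrable D (EFin \o (fun x => CRe (g x))).
Proof.
move=> [m1 m2 [M gM]]; apply: (bounded_integrable (M := M)) => // x Dx.
exact: le_trans (normc_geRe _) (gM _ Dx).
Qed.

Lemma bounded_measurable_intIm g : bounded_measurable g ->
  mu.-integrable D (EFin \o (fun x => CIm (g x))).
Proof.
move=> [m1 m2 [M gM]]; apply: (bounded_integrable (M := M)) => // x Dx.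
exact: le_trans (normc_geIm _) (gM _ Dx).
Qed.

Lemma bounded_measurable_cst (c : R[i]) : bounded_measurable (fun=> c).
Proof. by split => //; exists (normc c). Qed.

Lemma bounded_measurableD g h : bounded_measurable g -> bounded_measurable h ->
  bounded_measurable (fun x => g x + h x).
Proof.
move=> [g1 g2 [M gM]] [h1 h2 [N hN]]; split.
- under eq_fun do rewrite CReD; exact: measurable_funD.
- under eq_fun do rewrite CImD; exact: measurable_funD.
- by exists (M + N) => x Dx; rewrite (le_trans (@le_normcD R _ _))// lerD ?gM ?hN.
Qed.

Lemma bounded_measurableM g h : bounded_measurable g -> bounded_measurable h ->
  bounded_measurable (fun x => g x * h x).
Proof.
move=> [g1 g2 [M gM]] [h1 h2 [N hN]]; split.
- under eq_fun do rewrite CReM; apply: measurable_funB; exact: measurable_funM.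
- under eq_fun do rewrite CImM; apply: measurable_funD; exact: measurable_funM.
- by exists (M * N) => x Dx; rewrite normcM ler_pM ?normc_ge0 ?gM ?hN.
Qed.

Lemma bounded_measurableV (E : T -> R[i]) (e : R) : 0 < e ->
  measurable_fun D (fun x => CRe (E x)) -> measurable_fun D (fun x => CIm (E x)) ->
  (forall x, D x -> e <= normc (E x)) -> bounded_measurable (fun x => (E x)^-1).
Proof.
move=> e0 m1 m2 eE.
have mV : measurable_fun D (fun x => (CRe (E x) ^+ 2 + CIm (E x) ^+ 2)^-1).
  under eq_fun do rewrite -powR_inv1 ?addr_ge0 ?sqr_ge0//.
  apply: (measurableT_comp (measurable_powR _)).
  by apply: measurable_funD; exact: measurable_funX.
split.
- by under eq_fun do rewrite CReV; exact: measurable_funM.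
- by under eq_fun do rewrite CImV; apply: measurable_funM => //; exact: measurableT_comp.
- exists e^-1 => x Dx; rewrite normcV lef_pV2 ?eE// posrE//.
  exact: lt_le_trans e0 (eE _ Dx).
Qed.

Lemma CintegralD g h : bounded_measurable g -> bounded_measurable h ->
  Cintegral mu D (fun x => g x + h x) = Cintegral mu D g + Cintegral mu D h.
Proof.
move=> bg bh; rewrite /Cintegral; apply: complex_eqP => /=.
- under eq_fun do rewrite CReD; rewrite RintegralD//; exact: bounded_measurable_intRe.
- under eq_fun do rewrite CImD; rewrite RintegralD//; exact: bounded_measurable_intIm.
Qed.

Lemma CintegralZ (c : R[i]) g : bounded_measurable g ->
  Cintegral mu D (fun x => c * g x) = c * Cintegral mu D g.
Proof.
move=> bg; have i1 := bounded_measurable_intRe bg; have i2 := bounded_measurable_intIm bg.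
have [g1 g2 [M gM]] := bg.
have iz (r : R) (f : T -> R) : measurable_fun D f -> (forall x, D x -> `|f x| <= M) ->
    mu.-integrable D (EFin \o (fun x => r * f x)).
  move=> mf fM; apply: (@bounded_integrable _ (`|r| * M)).
    exact: measurable_funM.
  by move=> x Dx; rewrite /= normrM ler_wpM2l// fM.
have r1 x (Dx : D x) := le_trans (normc_geRe _) (gM _ Dx).
have r2 x (Dx : D x) := le_trans (normc_geIm _) (gM _ Dx).
rewrite /Cintegral; apply: complex_eqP; rewrite ?ReImE /=.
- under eq_fun do rewrite CReM.
  by rewrite RintegralB ?RintegralZl//; exact: iz.
- under eq_fun do rewrite CImM.
  by rewrite RintegralD ?RintegralZl//; exact: iz.
Qed.

Lemma Cintegral_cst (c : R[i]) : mu D = 1%E -> Cintegral mu D (fun=> c) = c.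
Proof.
move=> D1; rewrite /Cintegral !Rintegral_cst//; apply: complex_eqP => /=.
- by rewrite D1 mulr1.
- by rewrite D1 mulr1.
Qed.

Lemma eq_Cintegral g h : (forall x, D x -> g x = h x) ->
  Cintegral mu D g = Cintegral mu D h.
Proof.
by move=> gh; rewrite /Cintegral; congr Complex; apply: eq_Rintegral => x;
  rewrite inE => Dx; rewrite gh.
Qed.

Hypothesis D1 : mu D = 1%E.

(** The pointwise inequalities satisfied by the kernels below are affine in the
    kernel, so they pass to the integral, which is affine in it as well. *)
Lemma Cintegral_affine g (al : R[i]) (ga : R) : bounded_measurable g ->
  CRe (al * Cintegral mu D g) + ga =
  \int[mu]_(x in D) (CRe (al * g x) + ga).
Proof.
move=> bg; transitivity (CRe (Cintegral mu D (fun x => al * g x + ga%:C))).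
  rewrite CintegralD ?CintegralZ ?Cintegral_cst ?CReD//; [|exact: bounded_measurable_cst].
  by apply: bounded_measurableM => //; exact: bounded_measurable_cst.
by apply: eq_Rintegral => x _; rewrite CReD.
Qed.

Lemma Cintegral_affine_ge0 g (al : R[i]) (ga : R) : bounded_measurable g ->
  (forall x, D x -> 0 <= CRe (al * g x) + ga) ->
  0 <= CRe (al * Cintegral mu D g) + ga.
Proof. by move=> bg h; rewrite Cintegral_affine// Rintegral_ge0. Qed.

Lemma Cintegral_affine_gt0 g (al : R[i]) (ga : R) : bounded_measurable g ->
  (forall x, D x -> 0 <= CRe (al * g x) + ga) ->
  (mu [set x | D x /\ (CRe (al * g x) + ga)%R = 0%R] < 1)%E ->
  0 < CRe (al * Cintegral mu D g) + ga.
Proof.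
move=> bg h h0; rewrite Cintegral_affine//.
have [g1 g2 [M gM]] : bounded_measurable (fun x => al * g x + ga%:C).
  apply: bounded_measurableD; last exact: bounded_measurable_cst.
  by apply: bounded_measurableM => //; exact: bounded_measurable_cst.
apply: (@Rintegral_gt0 _ M) => //.
- by move: g1; under eq_fun do rewrite CReD.
- by move=> x /gM; apply: le_trans; rewrite (le_trans _ (normc_geRe _))// CReD.
Qed.

(** Jensen's inequality for the squared modulus: [|g|^2] lies above its tangent
    [2 Re (conj S * g) - |S|^2] at the mean [S], and the hypothesis trades
    [be * |g|^2] for an affine function of [g]. *)
Lemma Cintegral_sqr_le g (al : R[i]) (ga be : R) : bounded_measurable g -> 0 <= be ->
  (forall x, D x -> CRe (al * g x) + ga = be * normc (g x) ^+ 2) ->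
  be * normc (Cintegral mu D g) ^+ 2 <= CRe (al * Cintegral mu D g) + ga.
Proof.
move=> bg be0 h; set S := Cintegral mu D g.
have h' x : D x -> 0 <= CRe ((al - (2 * be)%:C * conjc S) * g x) +
    (ga + be * normc S ^+ 2).
  move=> Dx.
  rewrite mulrBl CReD CReN addrACA h// !sqr_normcE [leRHS](_ : _ =
    be * ((CRe (g x) - CRe S) ^+ 2 + (CIm (g x) - CIm S) ^+ 2)).
    by rewrite mulr_ge0// addr_ge0 ?sqr_ge0.
  by rewrite !ReImE; case: (S) => a b /=; ring.
have := Cintegral_affine_ge0 bg h'; rewrite -/S.
rewrite !sqr_normcE !ReImE; case: (S) => a b /=; nra.
Qed.

Lemma Cintegral_cvg (g_ : nat -> T -> R[i]) (g : T -> R[i]) (M : R) :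
  (forall n, bounded_measurable (g_ n)) -> bounded_measurable g ->
  (forall n x, D x -> normc (g_ n x) <= M) ->
  (forall x, D x -> (g_ n x : Cplx R) @[n --> \oo] --> (g x : Cplx R)) ->
  Cintegral mu D (g_ n) @[n --> \oo] --> Cintegral mu D g.
Proof.
move=> bg_ [g1 g2 _] gM gc; apply/cvgC_ReIm; split; apply: (@Rintegral_bounded_cvg _ _ M) => //.
- by move=> n; have [] := bg_ n.
- by move=> n x Dx; rewrite (le_trans (normc_geRe _))// gM.
- by move=> x /gc /cvgC_ReIm[].
- by move=> n; have [] := bg_ n.
- by move=> n x Dx; rewrite (le_trans (normc_geIm _))// gM.
- by move=> x /gc /cvgC_ReIm[].
Qed.

End Meas.

(** * Sums of weights *)

Section Star.
Context (T : eqType) (R : realFieldType).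
Variables (P : T -> Prop).

(** [e] is mass set aside outside of [P]; on the half-line it is the mass at 0. *)
Definition subprobability_weights (p : T -> R) (e : R) : Prop :=
  forall s, uniq s -> (forall x, x \in s -> P x) -> \sum_(x <- s) p x + e <= 1.

Let mass_le1 (p : T -> R) (e : R) (a : T) : 0 <= e ->
  subprobability_weights p e -> P a -> p a <= 1 - e.
Proof.
move=> e0 pe Pa; have := pe [:: a] isT; rewrite big_seq1 => h.
have {h} := h; rewrite lerBrDr; apply => x; rewrite inE => /eqP->; exact: Pa.
Qed.

(** All the pairs share the component [a].  Summing [p1 a + p2 (B c) = p c + 1]
    over the [n] elements of [s] gives
    [n * (p1 a - 1) + \sum p2 (B c) + e = 1].  If [e <= e2] the last two terms
    on the left are at most 1, whence [p1 a = 1].  If [e <= e1 <= 1 - p1 a] only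
    [(n - 1) * (p1 a - 1) + \sum p2 (B c) >= 1] remains, which says again that
    [p1 a = 1] if [n > 1], and that [p2 (B c) = 1] if [n = 1]. *)
Let unit_weight_of_common_summand (p p1 p2 : T -> R) (s : seq T) (e e1 e2 : R)
    (B : T -> T) (a : T) :
  uniq s -> s != [::] -> 0 <= e1 -> 0 <= e2 ->
  subprobability_weights p1 e1 -> subprobability_weights p2 e2 ->
  \sum_(c <- s) p c + e = 1 -> (e <= e1 \/ e <= e2) ->
  P a -> (forall c, c \in s -> P (B c)) -> {in s &, injective B} ->
  (forall c, c \in s -> p1 a + p2 (B c) = p c + 1) ->
  p1 a = 1 \/ exists2 b, P b & p2 b = 1.
Proof.
move=> us s0 e10 e20 w1 w2 spe ee Pa PB injB h.
have a1 := mass_le1 e10 w1 Pa.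
have sB : \sum_(c <- s) p2 (B c) + e2 <= 1.
  rewrite -(big_map B predT p2); apply: w2; first by rewrite map_inj_in_uniq.
  by move=> x /mapP[c cs ->]; exact: PB.
have tot : p1 a * (size s)%:R + \sum_(c <- s) p2 (B c) = 1 - e + (size s)%:R.
  have : \sum_(c <- s) (p1 a + p2 (B c)) = \sum_(c <- s) (p c + 1).
    by apply: eq_big_seq => c cs; exact: h.
  rewrite !big_split /= !big_const_seq !count_predT !iter_addr_0 => tot.
  by rewrite mulr_natr tot -spe addrK.
have n1 : 1 <= (size s)%:R :> R by rewrite ler1n lt0n size_eq0.
have [e2e|[_ e1e]] : e <= e2 \/ e2 < e /\ e <= e1.
- have [|] := leP e e2; first by left.
  by case: ee => [? ?|e2e]; [right|rewrite ltNge e2e].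
- by left; apply/eqP; rewrite eq_le; apply/andP; split; nra.
case: (ltnP 1 (size s)) => [n2|].
  have {}n2 : 2 <= (size s)%:R :> R by rewrite ler_nat.
  by left; apply/eqP; rewrite eq_le; apply/andP; split; nra.
move: us s0 spe PB injB h sB tot n1; case: s => // c [|//] _ _ spe PB _ h.
rewrite !big_seq1 /= => sB tot _; right.
have cc : c \in [:: c] by rewrite inE.
exists (B c); first exact: PB.
by apply/eqP; rewrite eq_le; apply/andP; split; lra.
Qed.

(** Two pairs [(a, b)] and [(a', b')] without a common component would satisfy
    [p1 a + p1 a' + p2 b + p2 b' <= 2], whereas the sum is [p c + p c' + 2].
    Edges of a bipartite graph which meet pairwise have a common vertex. *)
Lemma unit_weight_of_atom_sums (p p1 p2 : T -> R) (s : seq T) (e e1 e2 : R) (op : T -> T -> T) :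
  uniq s -> s != [::] -> 0 <= e1 -> 0 <= e2 ->
  subprobability_weights p1 e1 -> subprobability_weights p2 e2 ->
  \sum_(c <- s) p c + e = 1 -> (e <= e1 \/ e <= e2) ->
  (forall c, c \in s -> 0 < p c) ->
  (forall c, c \in s -> exists a b,
    [/\ P a, P b, op a b = c & p1 a + p2 b = p c + 1]) ->
  (exists2 a, P a & p1 a = 1) \/ (exists2 b, P b & p2 b = 1).
Proof.
move=> us s0 e10 e20 w1 w2 spe ee p0 h.
have /choice[AB hAB] c : exists ab : T * T, c \in s ->
    [/\ P ab.1, P ab.2, op ab.1 ab.2 = c & p1 ab.1 + p2 ab.2 = p c + 1].
  case: (boolP (c \in s)) => [/h[a [b ?]]|_]; first by exists (a, b).
  by exists (c, c).
pose A c := (AB c).1; pose B c := (AB c).2.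
have two (q : T -> R) (r : R) a b : 0 <= r -> subprobability_weights q r -> P a -> P b ->
    a != b -> q a + q b <= 1.
  move=> r0 w Pa Pb ab; have := w [:: a; b]; rewrite /= inE ab => /(_ isT).
  rewrite !big_cons big_nil addr0 => h'.
  suff : q a + q b + r <= 1 by lra.
  by apply: h' => x; rewrite !inE => /orP[] /eqP ->.
have meet c c' : c \in s -> c' \in s -> A c = A c' \/ B c = B c'.
  move=> cs cs'; have [|aa] := eqVneq (A c) (A c'); first by left.
  have [|bb] := eqVneq (B c) (B c'); first by right.
  have [P1 P2 _ e1'] := hAB _ cs; have [P3 P4 _ e2'] := hAB _ cs'.
  exfalso; have := two _ _ _ _ e10 w1 P1 P3 aa; have := two _ _ _ _ e20 w2 P2 P4 bb.
  by have := p0 _ cs; have := p0 _ cs'; lra.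
have [c0 c0s] : exists c0, c0 \in s.
  by case: (s) s0 => // c s' _; exists c; rewrite mem_head.
have [Aeq|] := pselect (forall c, c \in s -> A c = A c0).
  have [P1 P2 _ _] := hAB _ c0s.
  have inj : {in s &, injective B}.
    move=> c c' cs cs' Bcc; have [_ _ <- _] := hAB _ cs; have [_ _ <- _] := hAB _ cs'.
    by rewrite -/(A c) -/(A c') -/(B c) -/(B c') Aeq// (Aeq c')// Bcc.
  have [||?|?] := unit_weight_of_common_summand us s0 e10 e20 w1 w2 spe ee P1 _ inj.
  - by move=> c cs; have [] := hAB _ cs.
  - by move=> c cs; have [_ _ _] := hAB _ cs; rewrite -/(A c) Aeq.
  - by left; exists (AB c0).1.
  - by right.
move=> /existsNP[c1 /not_implyP[c1s /eqP A10]].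
have Beq c : c \in s -> B c = B c0.
  move=> cs; have B10 : B c1 = B c0.
    by have [/eqP|//] := meet c1 c0 c1s c0s; rewrite (negbTE A10).
  have [e0|//] := meet c c0 cs c0s.
  have [e1'|->//] := meet c c1 cs c1s.
  by move: A10; rewrite -e1' e0 eqxx.
have [P1 P2 _ _] := hAB _ c0s.
have inj : {in s &, injective A}.
  move=> c c' cs cs' Acc; have [_ _ <- _] := hAB _ cs; have [_ _ <- _] := hAB _ cs'.
  by rewrite -/(A c) -/(A c') -/(B c) -/(B c') Beq// (Beq c')// Acc.
have ee' : e <= e2 \/ e <= e1 by case: ee; [right|left].
have [||?|?] := unit_weight_of_common_summand us s0 e20 e10 w2 w1 spe ee' P2 _ inj.
- by move=> c cs; have [] := hAB _ cs.
- by move=> c cs; have [_ _ _] := hAB _ cs; rewrite -/(B c) Beq// addrC.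
- by right; exists (AB c0).2.
- by left.
Qed.

End Star.

Section Mass.
Context d (T : measurableType d) (R : realType).
Hypothesis mpt : forall a : T, measurable [set a].
Variable mu : probability T R.

Definition mass (a : T) : R := fine (mu [set a]).

Lemma mass_EFin a : (mass a)%:E = mu [set a].
Proof. by rewrite fineK// fin_num_measure. Qed.

Lemma mass_ge0 a : 0 <= mass a.
Proof. by rewrite -lee_fin mass_EFin. Qed.

Lemma set_seq_cons (a : T) (s : seq T) : [set` a :: s] = [set a] `|` [set` s].
Proof.
apply/seteqP; split => [x /=|x /=]; rewrite inE; first by case/orP => [/eqP|]; [left|right].
by case => [->|->]; rewrite ?eqxx ?orbT.
Qed.

Lemma measurable_seq (s : seq T) : measurable [set` s].
Proof.
elim: s => [|a s IH]; first by rewrite classical_sets.set_nil.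
by rewrite set_seq_cons; apply: measurableU.
Qed.

Lemma sum_mass (s : seq T) : uniq s -> (\sum_(a <- s) mass a)%:E = mu [set` s].
Proof.
elim: s => [|a s IH] /=; first by rewrite big_nil classical_sets.set_nil measure0.
move=> /andP[/negP as_ us]; rewrite big_cons EFinD IH// set_seq_cons measureU//.
- by rewrite mass_EFin.
- exact: measurable_seq.
- by apply/seteqP; split => // x [/= ->].
Qed.

Lemma sum_mass_le1 (s : seq T) : uniq s -> \sum_(a <- s) mass a <= 1.
Proof.
by move=> us; rewrite -lee_fin sum_mass// probability_le1//; exact: measurable_seq.
Qed.

Lemma mass_weights (P : T -> Prop) : subprobability_weights P mass 0.
Proof. by move=> s us _; rewrite addr0; exact: sum_mass_le1. Qed.

Lemma sum_mass1 (s : seq T) : uniq s -> mu [set` s] = 1%E -> \sum_(a <- s) mass a = 1.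
Proof. by move=> us s1; apply: (@EFin_inj R); rewrite sum_mass. Qed.

Lemma seq_neq_nil (s : seq T) : mu [set` s] = 1%E -> s != [::].
Proof.
move=> s1; apply/eqP => se; move: s1; rewrite se classical_sets.set_nil measure0.
by move/(@EFin_inj R)/eqP; rewrite eq_sym oner_eq0.
Qed.

End Mass.

(** * Atoms and boundary limits *)

Section Kernel.
Context d (T : measurableType d) (R : realType) (D : set T).
Hypothesis mD : measurable D.
Hypothesis mpt : forall a : T, measurable [set a].
Variable Ker : R[i] -> T -> R[i].
Hypothesis Ker_measRe : forall w, measurable_fun D (fun x => CRe (Ker w x)).
Hypothesis Ker_measIm : forall w, measurable_fun D (fun x => CIm (Ker w x)).
(* [Ker w x] stands for [w - x] or [1 - w * x], small for one [x] at a time *)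
Hypothesis Ker_sep : forall a x, D a -> D x -> a <> x -> forall w : nat -> R[i],
  (Ker (w k) a : Cplx R) @[k --> \oo] --> (0 : Cplx R) ->
  exists2 l : Cplx R, l != 0 & (Ker (w k) x : Cplx R) @[k --> \oo] --> l.

Local Notation S mu w := (Cintegral mu D (fun x => (Ker w x)^-1)).

Lemma cvg_of_ge_id (phi : nat -> nat) : (forall k, (k <= phi k)%N) -> phi @ \oo --> \oo.
Proof.
move=> h A [N _ NA]; exists N => // k /= Nk; apply: NA => /=.
exact: leq_trans Nk (h k).
Qed.

Lemma Cintegral_indic (mu : probability T R) (a : T) : D a ->
  Cintegral mu D (fun x => (\1_[set a] x)%:C) = (mass mu a)%:C.
Proof.
move=> Da; rewrite /Cintegral /=; apply: complex_eqP => /=.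
  rewrite /Rintegral integral_indic// /mass; congr (fine (mu _)).
  by apply/seteqP; split => [x []//|x /= ->].
by rewrite Rintegral_cst// mul0r.
Qed.

Lemma bounded_measurable_indic (a : T) : bounded_measurable D (fun x => (\1_[set a] x)%:C : R[i]).
Proof.
split; [exact: measurable_indic|exact: measurable_cst|].
by exists 1 => x _; rewrite normc_real indicE; case: (x \in _); rewrite ?normr1 ?normr0.
Qed.

(** The quotient [Ker (w k) a / Ker (w k) x] is bounded by [C] and tends to the
    indicator of [a], so that dominated convergence picks out the mass at [a]. *)
Lemma atom_limit (mu : probability T R) (w : nat -> R[i]) (y : nat -> R) (C : R)
    (a : T) : D a ->
  (forall k, 0 < y k) -> y @ \oo --> (0 : R) ->
  (forall k x, D x -> y k <= normc (Ker (w k) x)) ->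
  (forall k, normc (Ker (w k) a) <= C * y k) ->
  (Ker (w k) a : Cplx R) @[k --> \oo] --> (0 : Cplx R) /\
  (Ker (w k) a * S mu (w k) : Cplx R) @[k --> \oo]
    --> ((mass mu a)%:C : Cplx R).
Proof.
move=> Da y0 ycvg yK KC.
have K0 : (Ker (w k) a : Cplx R) @[k --> \oo] --> (0 : Cplx R).
  apply/cvgC0; apply: (@squeeze_cvgr _ _ _ _ (fun=> 0) (fun k => C * y k)).
  - by apply: nearW => k; rewrite normc_ge0 KC.
  - exact: cvg_cst.
  - by rewrite -(mulr0 C); apply: cvgMr.
have bV k : bounded_measurable D (fun x => (Ker (w k) x)^-1).
  by apply: (bounded_measurableV (y0 k)) => //; exact: yK.
split; first exact: K0.
rewrite -(Cintegral_indic mu Da).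
under eq_fun do rewrite -(CintegralZ mu mD _ (bV _)).
apply: (@Cintegral_cvg _ _ _ mu D mD
  (fun k x => Ker (w k) a * (Ker (w k) x)^-1) (fun x => (\1_[set a] x)%:C) C).
- by move=> k; apply: bounded_measurableM => //; exact: bounded_measurable_cst.
- exact: bounded_measurable_indic.
- move=> k x Dx; rewrite normcM normcV ler_pdivrMr; last exact: lt_le_trans (y0 k) (yK _ _ Dx).
  rewrite (le_trans (KC k))// ler_wpM2l ?yK//.
  have := le_trans (yK k _ Da) (KC k).
  by rewrite -[leLHS]mul1r ler_pM2r//; apply: le_trans.
- move=> x Dx; rewrite indicE; have [->|xa] := pselect (x = a).
    have -> : a \in [set a] = true by rewrite mem_set.
    have -> : (fun k => Ker (w k) a * (Ker (w k) a)^-1) = (fun=> 1).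
      apply/funext => k.
      by rewrite mulfV// -normc_gt0 (lt_le_trans (y0 k))// yK.
    exact: cvg_cst.
  have -> : x \in [set a] = false by rewrite memNset.
  have [l l0 hl] := Ker_sep Da Dx (nesym xa) K0.
  have -> : (false%:R)%:C = 0 * l^-1 :> Cplx R by rewrite mul0r.
  exact: (cvgM K0 (cvgV l0 hl)).
Qed.

(** If [y k / Ker (w k) a] tended to 0 for every [a], so would [y k * S] by
    dominated convergence.  Hence some [a] satisfies [|Ker (w k) a| <= y k / e]
    along a subsequence: there [w k] approaches the boundary point where the kernel
    of [a] vanishes, and does so nontangentially. *)
Lemma subordinate_atom (mu : probability T R) (w : nat -> R[i]) (y : nat -> R)
    (e0 : R) : mu D = 1%E ->
  (forall k, 0 < y k) -> y @ \oo --> (0 : R) ->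
  (forall k x, D x -> y k <= normc (Ker (w k) x)) ->
  0 < e0 -> (forall k, e0 <= y k * normc (S mu (w k))) ->
  exists a, exists2 phi : nat -> nat, D a /\ (forall k, (k <= phi k)%N) &
  (Ker (w (phi k)) a : Cplx R) @[k --> \oo] --> (0 : Cplx R) /\
  (Ker (w (phi k)) a * S mu (w (phi k)) : Cplx R) @[k --> \oo]
    --> ((mass mu a)%:C : Cplx R).
Proof.
move=> D1 y0 ycvg yK e00 e0S.
have bV k : bounded_measurable D (fun x => (Ker (w k) x)^-1).
  by apply: (bounded_measurableV (y0 k)) => //; exact: yK.
have [[a [Da na]]|nex] := pselect (exists a, D a /\
    ~ ((y k)%:C * (Ker (w k) a)^-1 : Cplx R) @[k --> \oo] --> (0 : Cplx R)).
  have [e e_gt0 he] : exists2 e : R, 0 < e &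
      forall N, exists2 k, (N <= k)%N & e <= y k / normc (Ker (w k) a).
    apply: contrapT => ne; apply: na; apply/cvgC0/cvgrPdist_lt => e e_gt0.
    apply: contrapT => h; apply: ne; exists e => // N.
    apply: contrapT => h'; apply: h; exists N => // k /= Nk.
    rewrite sub0r normrN ger0_norm ?normc_ge0// normcM normcV.
    rewrite ltNge; apply/negP => h2; apply: h'; exists k => //.
    by apply: le_trans h2 _; rewrite normc_real gtr0_norm.
  have /choice[phi hphi] N : exists k, (N <= k)%N /\ e <= y k / normc (Ker (w k) a).
    by have [k ? ?] := he N; exists k.
  exists a, phi.
    by split => // k; have [] := hphi k.
  apply: (@atom_limit mu (w \o phi) (y \o phi) e^-1) => //=.
  - by apply: cvg_comp ycvg; apply: cvg_of_ge_id => k; have [] := hphi k.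
  - by move=> k x Dx; exact: yK.
  - move=> k; have [_] := hphi k; rewrite ler_pdivlMr; last first.
      exact: lt_le_trans (y0 _) (yK _ _ Da).
    by rewrite ler_pdivlMl// mulrC.
have : (y k)%:C * S mu (w k) @[k --> \oo] --> (0 : Cplx R).
  rewrite -(Cintegral_cst mD 0 D1).
  under eq_fun do rewrite -(CintegralZ mu mD _ (bV _)).
  apply: (@Cintegral_cvg _ _ _ mu D mD
    (fun k x => (y k)%:C * (Ker (w k) x)^-1) (fun=> 0) 1).
  - by move=> k; apply: bounded_measurableM => //; exact: bounded_measurable_cst.
  - exact: bounded_measurable_cst.
  - move=> k x Dx; rewrite normcM normcV ler_pdivrMr; last exact: lt_le_trans (y0 k) (yK _ _ Dx).
    by rewrite mul1r normc_real gtr0_norm ?yK.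
  - by move=> x Dx; apply: contrapT => h; apply: nex; exists x.
move=> /cvgC0/cvgrPdist_lt /(_ _ e00)[N _ hN]; have {hN} := hN N (leqnn N).
rewrite sub0r normrN ger0_norm ?normc_ge0// normcM ltNge.
have -> : normc (y N)%:C = y N by rewrite normc_real gtr0_norm.
by rewrite e0S.
Qed.

Lemma subordinate_atoms (mu1 mu2 : probability T R) (w1 w2 : nat -> R[i])
    (s : nat -> Cplx R) (y : nat -> R) (e0 : R) : mu1 D = 1%E -> mu2 D = 1%E ->
  (forall k, 0 < y k) -> y @ \oo --> (0 : R) ->
  (forall k x, D x -> y k <= normc (Ker (w1 k) x)) ->
  (forall k x, D x -> y k <= normc (Ker (w2 k) x)) ->
  (forall k, S mu1 (w1 k) = s k) -> (forall k, S mu2 (w2 k) = s k) ->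
  0 < e0 -> (forall k, e0 <= y k * normc (s k)) ->
  exists a b, exists2 phi : nat -> nat, [/\ D a, D b & forall k, (k <= phi k)%N] &
  [/\ (Ker (w1 (phi k)) a : Cplx R) @[k --> \oo] --> (0 : Cplx R),
    (Ker (w2 (phi k)) b : Cplx R) @[k --> \oo] --> (0 : Cplx R),
    (Ker (w1 (phi k)) a * s (phi k) : Cplx R) @[k --> \oo]
      --> ((mass mu1 a)%:C : Cplx R) &
    (Ker (w2 (phi k)) b * s (phi k) : Cplx R) @[k --> \oo]
      --> ((mass mu2 b)%:C : Cplx R)].
Proof.
move=> D1 D2 y0 ycvg y1 y2 s1 s2 e00 e0s.
have [a [phi [Da phik] [ha hma]]] : exists a, exists2 phi : nat -> nat,
    D a /\ (forall k, (k <= phi k)%N) &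
    (Ker (w1 (phi k)) a : Cplx R) @[k --> \oo] --> (0 : Cplx R) /\
    (Ker (w1 (phi k)) a * S mu1 (w1 (phi k)) : Cplx R) @[k --> \oo]
      --> ((mass mu1 a)%:C : Cplx R).
  apply: (subordinate_atom (y := y) (e0 := e0)) => // k.
  by rewrite s1.
have [b [psi [Db psik] [hb hmb]]] : exists b, exists2 psi : nat -> nat,
    D b /\ (forall k, (k <= psi k)%N) &
    (Ker ((w2 \o phi) (psi k)) b : Cplx R) @[k --> \oo] --> (0 : Cplx R) /\
    (Ker ((w2 \o phi) (psi k)) b * S mu2 ((w2 \o phi) (psi k)) : Cplx R) @[k --> \oo]
      --> ((mass mu2 b)%:C : Cplx R).
  apply: (subordinate_atom (y := y \o phi) (e0 := e0)) => //=.
  - by apply: cvg_comp ycvg; exact: cvg_of_ge_id.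
  - by move=> k x; exact: y2.
  - by move=> k; have := e0s (phi k); rewrite -s2; exact.
exists a, b, (phi \o psi).
  by split=> // k; apply: leq_trans (psik k) (phik _).
have psic := cvg_of_ge_id psik.
split.
- exact: (cvg_comp psi (fun k => Ker (w1 (phi k)) a : Cplx R) psic ha).
- exact: hb.
- move: hma; under eq_fun do rewrite s1.
  exact: (cvg_comp psi (fun k => Ker (w1 (phi k)) a * s (phi k) : Cplx R) psic).
- by move: hmb; under eq_fun do rewrite /= s2.
Qed.

(** At an atom [c] of [mu] the common value [s] of the three integrals grows like
    [1 / y], which is the growth required by [subordinate_atom].  The conditions on
    [w1] and [w2] are only asked for where [|1 / s| < 1], which holds eventually:
    on the circle this keeps away from the zeros of [Q_mu = 1 - 1 / s]. *)
Lemma subordination_at_atom (mu mu1 mu2 : probability T R) (z w1 w2 : nat -> R[i])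
    (y : nat -> R) (C : R) (c : T) (s := fun k => S mu (z k) : Cplx R) :
  mu1 D = 1%E -> mu2 D = 1%E -> D c -> 0 < mass mu c ->
  (forall k, 0 < y k) -> y @ \oo --> (0 : R) ->
  (forall k x, D x -> y k <= normc (Ker (z k) x)) ->
  (forall k, normc (Ker (z k) c) <= C * y k) ->
  (forall k, normc (s k)^-1 < 1 ->
    [/\ forall x, D x -> y k <= normc (Ker (w1 k) x),
        forall x, D x -> y k <= normc (Ker (w2 k) x),
        S mu1 (w1 k) = s k & S mu2 (w2 k) = s k]) ->
  exists a b, exists2 phi : nat -> nat, D a /\ D b &
  [/\ ((s (phi k))^-1 : Cplx R) @[k --> \oo] --> (0 : Cplx R),
    [/\ (Ker (z (phi k)) c : Cplx R) @[k --> \oo] --> (0 : Cplx R),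
    (Ker (w1 (phi k)) a : Cplx R) @[k --> \oo] --> (0 : Cplx R) &
    (Ker (w2 (phi k)) b : Cplx R) @[k --> \oo] --> (0 : Cplx R)],
    (Ker (z (phi k)) c * s (phi k) : Cplx R) @[k --> \oo]
      --> ((mass mu c)%:C : Cplx R),
    (Ker (w1 (phi k)) a * s (phi k) : Cplx R) @[k --> \oo]
      --> ((mass mu1 a)%:C : Cplx R) &
    (Ker (w2 (phi k)) b * s (phi k) : Cplx R) @[k --> \oo]
      --> ((mass mu2 b)%:C : Cplx R)].
Proof.
move=> D1 D2 Dc mc0 y0 ycvg yK KC hw.
have [Kc0 Kcs] := atom_limit mu Dc y0 ycvg yK KC.
have C1 : 1 <= C.
  by have := le_trans (yK 0%N _ Dc) (KC 0%N); rewrite -[leLHS]mul1r ler_pM2r.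
have C0 : 0 < C by exact: lt_le_trans C1.
(* eventually [mass mu c / 2 <= |Ker (z k) c * s k| <= C * y k * |s k|] *)
pose e0 := mass mu c / 2 / C.
have e00 : 0 < e0 by rewrite !divr_gt0.
have [N1 _ hN1] : \forall k \near \oo, e0 <= y k * normc (s k).
  move/cvgC_normc : Kcs => /cvgrPdist_lt /(_ (mass mu c / 2)).
  rewrite divr_gt0// => /(_ isT); apply: filterS => k.
  rewrite sub0r normrN ger0_norm ?normc_ge0// => h.
  rewrite /e0 ler_pdivrMr//; apply: (@le_trans _ _ (normc (Ker (z k) c * s k))).
    have := @le_normcB R (mass mu c)%:C (- ((mass mu c)%:C - Ker (z k) c * s k)).
    rewrite normcN opprB addrCA subrr addr0 => h'; apply: le_trans h'.
    have -> : normc (mass mu c)%:C = mass mu c.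
      by rewrite normc_real gtr0_norm.
    move: h; set x := normc _; move: mc0; set m := mass _ _; move=> mc0 h; lra.
  rewrite normcM mulrAC ler_wpM2r ?normc_ge0// mulrC; exact: KC.
have s0 : ((s k)^-1 : Cplx R) @[k --> \oo] --> (0 : Cplx R).
  apply/cvgC0; apply: (@squeeze_cvgr _ _ _ _ (fun=> 0) (fun k => y k / e0)).
  - exists N1 => // k Nk; rewrite normc_ge0 normcV ler_pdivlMr//.
    have h := hN1 k Nk; rewrite mulrC ler_pdivrMr//.
    rewrite lt_neqAle normc_ge0 andbT; apply/eqP => n0.
    by move: h; rewrite -n0 mulr0 leNgt e00.
  - exact: cvg_cst.
  - by rewrite -(mul0r e0^-1); apply: cvgMl.
have [N2 _ hN2] : \forall k \near \oo, normc (s k)^-1 < 1.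
  move/cvgC0 : (s0) => /cvgrPdist_lt /(_ 1 ltr01); apply: filterS => k.
  by rewrite sub0r normrN ger0_norm ?normc_ge0.
pose sh k := (k + (N1 + N2))%N.
have shc : sh @ \oo --> \oo by apply: cvg_of_ge_id => k; exact: leq_addr.
have hsh k : [/\ forall x, D x -> y (sh k) <= normc (Ker (w1 (sh k)) x),
        forall x, D x -> y (sh k) <= normc (Ker (w2 (sh k)) x),
        S mu1 (w1 (sh k)) = s (sh k) & S mu2 (w2 (sh k)) = s (sh k)].
  by apply: hw; apply: hN2 => /=; rewrite /sh addnA leq_addl.
have [a [b [phi [Da Db phik] [h1 h2 h3 h4]]]] := @subordinate_atoms mu1 mu2
  (w1 \o sh) (w2 \o sh) (s \o sh) (y \o sh) e0 D1 D2 (fun k => y0 (sh k))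
  (cvg_comp sh y shc ycvg)
  (fun k => let: And4 h _ _ _ := hsh k in h) (fun k => let: And4 _ h _ _ := hsh k in h)
  (fun k => let: And4 _ _ h _ := hsh k in h) (fun k => let: And4 _ _ _ h := hsh k in h)
  e00 (fun k => hN1 (sh k) (leq_trans (leq_addr _ _) (leq_addl _ _))).
have phic := cvg_comp phi sh (cvg_of_ge_id phik) shc.
exists a, b, (sh \o phi); first by split.
split; [|split| | |].
- exact: (cvg_comp _ _ phic s0).
- exact: (cvg_comp _ _ phic Kc0).
- exact: h1.
- exact: h2.
- exact: (cvg_comp _ _ phic Kcs).
- exact: h3.
- exact: h4.
Qed.

End Kernel.

(** * Finite supports *)

Lemma BorelC_open (R : realType) (U : set (Cplx R)) : open U ->
  measurable (U : set (BorelC R)).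
Proof. by move=> oU; apply: sub_sigma_algebra. Qed.

Lemma continuous_CRe (R : realType) : continuous (@CRe R : Cplx R -> R).
Proof. by move=> x; have /cvgC_ReIm[] : (id : Cplx R -> Cplx R) @ x --> x by exact: cvg_id. Qed.

Lemma continuous_CIm (R : realType) : continuous (@CIm R : Cplx R -> R).
Proof. by move=> x; have /cvgC_ReIm[] : (id : Cplx R -> Cplx R) @ x --> x by exact: cvg_id. Qed.

Lemma BorelC_continuous (R : realType) (D : set (BorelC R)) (f : Cplx R -> R) :
  measurable D -> continuous f -> measurable_fun D (f : BorelC R -> R).
Proof.
move=> mD /continuousP cf; apply: (measurable_funS measurableT) => //.
apply: (measurability _ (RGenOpens.measurableE R)) => // _ [_ [a [b ->] <-]].
rewrite setTI; apply: BorelC_open; apply: cf; exact: interval_open.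
Qed.

Lemma measurable_CRe (R : realType) (D : set (BorelC R)) : measurable D ->
  measurable_fun D (@CRe R : BorelC R -> R).
Proof. by move=> mD; apply: BorelC_continuous => //; exact: continuous_CRe. Qed.

Lemma measurable_CIm (R : realType) (D : set (BorelC R)) : measurable D ->
  measurable_fun D (@CIm R : BorelC R -> R).
Proof. by move=> mD; apply: BorelC_continuous => //; exact: continuous_CIm. Qed.

Lemma BorelC_set1 (R : realType) (a : BorelC R) : measurable [set a].
Proof.
rewrite -(setCK [set a]); apply: measurableC; apply: BorelC_open.
rewrite openC; apply: accessible_closed_set1; apply: hausdorff_accessible.
exact: (@norm_hausdorff _ (Cplx R)).
Qed.

(** The Borel structure of the plane lives on an alias of the type that carries the
    topology; [op] stands for the open sets, whichever type they are declared on. *)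
Section FiniteSupport.
Context d (T : measurableType d) (R : realType) (mu : probability T R).
Variables (op : set T -> Prop) (I : countType) (b : I -> set T).
Hypothesis op_measurable : forall U, op U -> measurable U.
Hypothesis opI : forall U V, op U -> op V -> op (U `&` V).
Hypothesis opT : op setT.
Hypothesis op_set1C : forall a, op (~` [set a]).
Hypothesis op_b : forall i, op (b i).
Hypothesis op_basis : forall U x, op U -> U x -> exists2 i, b i x & b i `<=` U.

Let supp := [set x | forall U : set T, op U -> U x -> (0 < mu U)%E].

(** A point off the support has a null neighbourhood, which may be taken in the
    countable basis. *)
Let suppC0 : mu.-negligible (~` supp).
Proof.
pose B n := if unpickle n is Some i then if mu (b i) == 0%E then b i else set0 else set0.
apply: (@negligibleS _ _ _ _ (\bigcup_n B n)) => [x|].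
  move=> /existsNP[U /not_implyP[oU /not_implyP[Ux /negP]]].
  rewrite -leNgt measure_le0 => /eqP U0.
  have [i bix biU] := op_basis oU Ux.
  exists (pickle i) => //; rewrite /B pickleK ifT//.
  by rewrite -measure_le0 -U0 le_measure ?inE//; exact: op_measurable.
apply: negligible_bigcup => n; rewrite /B.
case: unpickle => [i|]; last exact: negligible_set0.
case: ifPn => [/eqP bi0|_]; last exact: negligible_set0.
by apply/negligibleP => //; exact: op_measurable.
Qed.

Lemma finite_support_atoms : finite_set supp ->
  exists s : seq T, [/\ uniq s, mu [set` s] = 1%E &
    forall c, c \in s -> (0 < mu [set c])%E].
Proof.
have mpt (a : T) : measurable [set a].
  by have := measurableC (op_measurable (op_set1C a)); rewrite setCK.
move=> /finite_seqP[s0 suppE]; pose s := undup s0.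
have sE : supp = [set` s].
  by rewrite suppE; apply/seteqP; split => x /=; rewrite mem_undup.
have ms (t : seq T) : measurable [set` t] by exact: measurable_seq.
have sC0 : mu (~` [set` s]) = 0%E.
  apply/negligibleP; first exact: measurableC.
  by rewrite -sE; exact: suppC0.
have oC (t : seq T) : op (~` [set` t]).
  elim: t => [|a t IH]; first by rewrite classical_sets.set_nil setC0.
  by rewrite set_seq_cons setCU; apply: opI.
exists s; split; first exact: undup_uniq.
  by have := probability_setC mu (measurableC (ms s)); rewrite setCK sC0 sube0.
move=> c cs; pose t := rem c s.
have : (0 < mu (~` [set` t]))%E.
  have : supp c by rewrite sE.
  by apply => //= ; rewrite mem_rem_uniqF// undup_uniq.
move=> /lt_le_trans; apply.
have sub : ~` [set` t] `<=` [set c] `|` ~` [set` s].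
  move=> x /= xt; have [->|xc] := eqVneq x c; [by left|right => xs; apply: xt].
  by rewrite /t mem_rem_uniq ?undup_uniq// inE xc.
rewrite (le_trans (le_measure _ _ _ sub))// ?inE.
- exact: measurableC.
- by apply: measurableU => //; exact: measurableC.
- have := measureU2 mu (mpt c) (measurableC (ms s)).
  by move=> h; apply: le_trans h _; rewrite [X in (_ + X)%E](_ : _ = 0%E) ?adde0.
Qed.

End FiniteSupport.

Lemma finite_support_atoms_R (R : realType) (mu : probability R R) :
  finite_set (msupport mu) ->
  exists s : seq R, [/\ uniq s, mu [set` s] = 1%E &
    forall c, c \in s -> (0 < mu [set c])%E].
Proof.
apply: (@finite_support_atoms _ _ _ _ (@open R) _
  (fun i : rat * rat => ball (ratr i.1 : R) (ratr i.2))).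
- exact: open_measurable.
- exact: openI.
- exact: openT.
- move=> a; rewrite openC; apply: accessible_closed_set1; apply: hausdorff_accessible.
  exact: norm_hausdorff.
- by move=> i; exact: ball_open.
- move=> U x oU Ux.
  have /nbhs_ballP[e /= e0 eU] : nbhs x U by exact: open_nbhs_nbhs.
  have [r] := @rat_in_itvoo R 0 (e / 2) (divr_gt0 e0 (ltr0n _ 2)).
  rewrite in_itv /= => /andP[r0 re].
  have [q] := @rat_in_itvoo R (x - ratr r) x (ltac:(by rewrite ltrBlDr ltrDl)).
  rewrite in_itv /= => /andP[qx1 qx2].
  exists (q, r) => /=; first by rewrite /ball /= ltr_distl; apply/andP; split; lra.
  move=> y; rewrite /ball /= ltr_distl => /andP[y1 y2].
  by apply: eU; rewrite /ball /= ltr_distl; apply/andP; split; lra.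
Qed.

Lemma finite_support_atoms_C (R : realType) (mu : probability (BorelC R) R) :
  finite_set (msupport (T := Cplx R) mu) ->
  exists s : seq (BorelC R), [/\ uniq s, mu [set` s] = 1%E &
    forall c, c \in s -> (0 < mu [set c])%E].
Proof.
pose b (i : rat * rat * rat) : set (Cplx R) :=
  [set z | ball (ratr i.1.1 : R) (ratr i.2) (CRe z)] `&`
  [set z | ball (ratr i.1.2 : R) (ratr i.2) (CIm z)].
apply: (@finite_support_atoms _ _ _ mu (@open (Cplx R)) _ b).
- exact: BorelC_open.
- exact: (@openI (Cplx R)).
- exact: (@openT (Cplx R)).
- move=> a; rewrite openC; apply: accessible_closed_set1; apply: hausdorff_accessible.
  exact: (@norm_hausdorff _ (Cplx R)).
- move=> i; apply: openI.
    have /continuousP := @continuous_CRe R; apply; exact: ball_open.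
  have /continuousP := @continuous_CIm R; apply; exact: ball_open.
- move=> U x oU Ux.
  have /nbhs_ballP[e' /= e0' eU] : nbhs (x : Cplx R) U by exact: open_nbhs_nbhs.
  have [e e0 ee] : exists2 e : R, 0 < e & e' = e%:C.
    move: e0'; rewrite ltcE => /andP[/eqP h1 h2]; exists (CRe e') => //.
    by apply: complex_eqP => //=; rewrite h1.
  have [r] := @rat_in_itvoo R 0 (e / 4) (divr_gt0 e0 (ltr0n _ 4)).
  rewrite in_itv /= => /andP[r0 re].
  have [p] := @rat_in_itvoo R (CRe x - ratr r) (CRe x) (ltac:(by rewrite ltrBlDr ltrDl)).
  rewrite in_itv /= => /andP[px1 px2].
  have [q] := @rat_in_itvoo R (CIm x - ratr r) (CIm x) (ltac:(by rewrite ltrBlDr ltrDl)).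
  rewrite in_itv /= => /andP[qx1 qx2].
  exists (p, q, r) => /=.
    by split; rewrite /ball /= ltr_distl; apply/andP; split; lra.
  move=> y [/=]; rewrite /ball /= !ltr_distl => /andP[y1 y2] /andP[y3 y4].
  apply: eU; rewrite /ball /= normr_normc ee ltcR (le_lt_trans (normc_le_ReIm _))// !ReImE.
  have : `|CRe x - CRe y| < e / 2 by rewrite ltr_distl; apply/andP; split; lra.
  have : `|CIm x - CIm y| < e / 2 by rewrite ltr_distl; apply/andP; split; lra.
  by lra.
Qed.

(** * Finitely supported probabilities *)

Section FiniteIntegral.
Context d (T : measurableType d) (R : realType) (mu : probability T R).
Hypothesis mpt : forall a : T, measurable [set a].
Variable D : set T.
Hypothesis mD : measurable D.

Lemma ae_eq_Cintegral (g h : T -> R[i]) (N : set T) :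
  bounded_measurable D g -> bounded_measurable D h ->
  measurable N -> mu N = 0%E -> (forall x, D x -> ~ N x -> g x = h x) ->
  Cintegral mu D g = Cintegral mu D h.
Proof.
move=> [g1 g2 _] [h1 h2 _] mN N0 gh; rewrite /Cintegral; congr Complex; congr fine.
- apply: ae_eq_integral => //; [exact/measurable_EFinP|exact/measurable_EFinP|].
  exists N; split => // x /=; apply: contra_notP => Nx Dx; by rewrite gh.
- apply: ae_eq_integral => //; [exact/measurable_EFinP|exact/measurable_EFinP|].
  exists N; split => // x /=; apply: contra_notP => Nx Dx; by rewrite gh.
Qed.

Lemma Cintegral_finite (s : seq T) (g : T -> R[i]) : uniq s -> mu [set` s] = 1%E ->
  (forall a, a \in s -> D a) -> bounded_measurable D g ->
  Cintegral mu D g = \sum_(a <- s) (mass mu a)%:C * g a.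
Proof.
move=> us s1 sD bg.
have ind (t : seq T) : (forall a, a \in t -> D a) ->
    bounded_measurable D (fun x => \sum_(a <- t) g a * (\1_[set a] x)%:C) /\
    Cintegral mu D (fun x => \sum_(a <- t) g a * (\1_[set a] x)%:C) =
    \sum_(a <- t) (mass mu a)%:C * g a.
  elim: t => [_|a t IH tD].
    under eq_fun do rewrite big_nil; rewrite big_nil; split; first exact: bounded_measurable_cst.
    by rewrite /Cintegral /= !Rintegral_cst// !mul0r.
  have [b1 b2] := IH (fun x xt => tD x (@mem_behead _ (a :: t) _ xt)).
  have b4 := bounded_measurable_indic R D mpt a.
  have b3 := bounded_measurableM (bounded_measurable_cst D (g a)) b4.
  under eq_fun do rewrite big_cons; rewrite big_cons; split; first exact: bounded_measurableD.
  rewrite (CintegralD mu mD b3 b1) b2; congr (_ + _).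
  rewrite CintegralZ//.
  by rewrite Cintegral_indic// 1?mulrC//; apply: tD; rewrite mem_head.
have [b1 <-] := ind s sD.
have ms : measurable [set` s] by exact: measurable_seq.
apply: (@ae_eq_Cintegral _ _ (~` [set` s])) => //; first exact: measurableC.
  by have := probability_setC mu ms; rewrite s1 subee.
move=> x Dx /contrapT /= xs.
rewrite (bigD1_seq x)//= indicE mem_set// mulr1 big1 ?addr0// => a ax.
by rewrite indicE memNset ?mulr0// => /= xa; rewrite xa eqxx in ax.
Qed.

Lemma same_measure_dirac (a : T) : mass mu a = 1 -> same_measure mu (\d_a : probability T R).
Proof.
move=> m1 A mA; have ma : mu [set a] = 1%E by rewrite -mass_EFin// m1.
rewrite /= diracE; case: (boolP (a \in A)) => [|/negP] aA.
  apply/eqP; rewrite eq_le probability_le1//= -[leLHS]/(1%E) -ma le_measure ?inE//.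
  by move=> x /= ->; rewrite inE in aA.
apply/eqP; rewrite -measure_le0.
have <- : mu (~` [set a]) = 0%E by rewrite probability_setC// ma subee.
rewrite le_measure ?inE//; first exact: measurableC.
by move=> x Ax /= xa; apply: aA; rewrite inE -xa.
Qed.

End FiniteIntegral.

Lemma mass_dirac d (T : measurableType d) (R : realType) (a : T) :
  mass (\d_a : probability T R) a = 1.
Proof.
by rewrite /mass (_ : (\d_a : probability T R) [set a] = 1%E)//= diracE mem_set.
Qed.

Section Discrete.
Context d (T : measurableType d) (R : realType) (n : nat).
Variables (p : 'I_n -> R) (l : 'I_n -> T).
Hypothesis p0 : forall j, 0 <= p j.
Hypothesis p1 : \sum_j p j = 1.

(** The measure [msum] takes sequences; only the values below [n] are read. *)
Definition discrete_weight (k : nat) : {nonneg R} :=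
  if insub k is Some j then NngNum (p0 j) else 0%:nng.
Definition discrete_point (k : nat) : T := if insub k is Some j then l j else point.

Definition discrete := msum (fun k =>
  mscale (discrete_weight k) (dirac (discrete_point k))) n.

HB.instance Definition _ := Measure.on discrete.

Lemma discreteE (A : set T) : discrete A = (\sum_j p j * (l j \in A)%:R)%:E.
Proof.
rewrite /discrete /msum -sumEFin; apply: eq_bigr => j _.
rewrite /= /mscale /= /discrete_weight /discrete_point valK /= diracE -EFinM.
by case: (l j \in A).
Qed.

Lemma discrete_setT : discrete setT = 1%E.
Proof.
by rewrite discreteE; congr EFin; rewrite -[RHS]p1; apply: eq_bigr => j _;
  rewrite mem_set// mulr1n mulr1.
Qed.

HB.instance Definition _ := Measure_isProbability.Build _ _ _ discrete discrete_setT.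

Definition discrete_probability : probability T R := discrete.

Hypothesis mpt : forall a : T, measurable [set a].

Lemma Cintegral_discrete (D : set T) (g : T -> R[i]) : measurable D ->
  (forall j, D (l j)) -> bounded_measurable D g ->
  Cintegral discrete_probability D g = \sum_j (p j)%:C * g (l j).
Proof.
move=> mD Dl bg; pose s := undup [seq l j | j <- enum 'I_n].
have ls j : l j \in s by rewrite mem_undup; apply: map_f; rewrite mem_enum.
have us : uniq s by exact: undup_uniq.
rewrite /discrete_probability (Cintegral_finite mpt mD us) //=; first last.
- by move=> a; rewrite mem_undup => /mapP[j _ ->].
- rewrite discreteE; congr EFin; rewrite -[RHS]p1; apply: eq_bigr => j _.
  by rewrite (mem_set (ls j : [set` s] (l j))) mulr1.
transitivity (\sum_(a <- s) \sum_j ((p j)%:C * g (l j)) * (l j == a)%:R).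
  apply: eq_bigr => a _.
  have -> : mass (discrete : probability T R) a = \sum_j p j * (l j == a)%:R.
    rewrite /mass /= discreteE /=; apply: eq_bigr => j _.
    congr (_ * _%:R); have [->|la] := eqVneq (l j) a; first by rewrite mem_set.
    by rewrite memNset// => /= e; rewrite e eqxx in la.
  rewrite (big_morph (real_complex R) (id1 := 0) (op1 := +%R))//; last first.
    by move=> x y; rewrite rmorphD.
  rewrite mulr_suml; apply: eq_bigr => j _.
  have [->|_] := eqVneq (l j) a; first by rewrite !mulr1.
  by rewrite !mulr0 mul0r.
rewrite exchange_big /=; apply: eq_bigr => j _.
rewrite (bigD1_seq (l j))//= eqxx mulr1 big1 ?addr0// => a.
by rewrite eq_sym => /negbTE ->; rewrite mulr0.
Qed.

End Discrete.

(** * Rank-one perturbations of diagonal matrices *)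

Section RankOne.
Context (R : realType).
Local Open Scope sesquilinear_scope.

(** Put [A = diag t + b e^T e].  The [l j] are the eigenvalues of this Hermitian
    matrix and the [p j] the squared moduli of the coordinates of [e] in a unitary
    eigenbasis, so that [s = e (w - A)^-1 e^T] is the sum on the left.  With
    [g = e (w - diag t)^-1 e^T], the resolvent identity gives [s = (1 + b s) g]. *)
Lemma rank_one_perturbation (n : nat) (t e : 'I_n -> R) (b : R) :
  \sum_j e j ^+ 2 = 1 ->
  exists p l : 'I_n -> R, [/\ forall j, 0 <= p j, \sum_j p j = 1 &
    forall w : R[i], 0 < CIm w ->
      \sum_j (p j)%:C / (w - (l j)%:C) =
      (1 + b%:C * \sum_j (p j)%:C / (w - (l j)%:C)) *
      \sum_j (e j ^+ 2)%:C / (w - (t j)%:C)].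
Proof.
move=> e1.
pose E : 'rV[R[i]]_n := \row_j (e j)%:C.
pose Tm : 'M[R[i]]_n := diag_mx (\row_j (t j)%:C).
pose M := Tm + b%:C *: (E^T *m E).
have Creal (x : R) : (x%:C)^*%R = x%:C :> R[i].
  by apply/CrealP; apply/complex_realP; exists x.
have Mherm : M \is (hermitianmx n false (@Num.conj R[i])).
  apply/is_hermitianmxP; rewrite expr0 scale1r; apply/matrixP => i j.
  rewrite !mxE rmorphD /= rmorphM /= Creal; congr (_ + _ * _).
    rewrite rmorphMn /= Creal eq_sym; by have [->|_] := eqVneq j i; rewrite ?mulr0n.
  by rewrite rmorph_sum; apply: eq_bigr => k _; rewrite !mxE rmorphM /= !Creal mulrC.
have /hermitian_normalmx/orthomx_spectralP ME := Mherm.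
have Dreal := hermitian_spectral_diag_real Mherm.
have PU := spectral_unitarymx M.
move: ME Dreal PU; set P := spectralmx M; set sp := spectral_diag M => ME Dreal PU.
have PP : P *m P^t* = 1%:M by exact/unitarymxP.
have PV : invmx P = P^t* by rewrite invmx_unitary.
have PP' : P^t* *m P = 1%:M by rewrite -PV mulVmx// unitarymx_unit.
pose l j := CRe (sp 0 j).
have lE j : sp 0 j = (l j)%:C.
  by rewrite /l RRe_real//; move/mxOverP: Dreal; exact.
pose v := E *m P^t*.
pose p j := normc (v 0 j) ^+ 2.
have PE j : (P *m E^T) j 0 = (v 0 j)^*%R.
  rewrite !mxE rmorph_sum; apply: eq_bigr => k _; rewrite !mxE rmorphM /= Creal.
  by rewrite mulrC conjCK.
have vE j : v 0 j * (v 0 j)^*%R = (p j)%:C.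
  by rewrite -normCK normr_normc -rmorphXn.
exists p, l; split; first by move=> j; exact: sqr_ge0.
  apply: (@complexI R); rewrite rmorph_sum rmorph1.
  transitivity ((v *m (P *m E^T)) 0 0).
    by rewrite mxE; apply: eq_bigr => j _; rewrite PE vE.
  rewrite /v !mulmxA -(mulmxA E) PP' mulmx1 mxE -(rmorph1 (real_complex R)) -e1 rmorph_sum.
  by apply: eq_bigr => j _; rewrite !mxE rmorphXn expr2.
move=> w w0.
have wl (x : R) : w - x%:C != 0.
  by apply/eqP => /(congr1 (@CIm R)); rewrite !ReImE /= subr0 => wi; rewrite wi ltxx in w0.
(* [X = e (w - A)^-1] *)
pose X : 'rV_n := v *m diag_mx (\row_j (w - (l j)%:C)^-1) *m P.
have XM : X *m (w%:M - M) = E.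
  have -> : w%:M - M = P^t* *m diag_mx (\row_j (w - (l j)%:C)) *m P.
    have -> : diag_mx (\row_j (w - (l j)%:C)) = w%:M - diag_mx sp.
      apply/matrixP => i j; rewrite !mxE lE -mulrnBl//.
    by rewrite mulmxBr mulmxBl -PV -ME PV scalar_mxC -mulmxA PP' mulmx1.
  rewrite /X !mulmxA -(mulmxA _ P) PP mulmx1 -(mulmxA v) mulmx_diag.
  rewrite (_ : (\row__ _) = const_mx 1); last first.
    by apply/rowP => j; rewrite !mxE mulVf.
  by rewrite diag_const_mx mulmx1 /v -mulmxA PP' mulmx1.
set s := \sum_j (p j)%:C / _.
have sE : (X *m E^T) 0 0 = s.
  rewrite /X -mulmxA mxE; apply: eq_bigr => j _; rewrite PE mul_mx_diag -vE !mxE.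
  by rewrite mulrAC.
have Xj j : X 0 j = (e j)%:C * (1 + b%:C * s) / (w - (t j)%:C).
  apply: (mulIf (wl (t j))); rewrite mulfVK//.
  have := congr1 (fun Y : 'rV_n => Y 0 j) XM; rewrite /M opprD addrA mulmxBr mulmxBr.
  rewrite mul_mx_scalar -scalemxAr mulmxA mul_mx_diag !mxE.
  rewrite (_ : \sum_(j0 < 1) _ = s * (e j)%:C); last first.
    by rewrite big_ord1 sE mxE.
  by move=> h; rewrite [RHS]mulrDr mulr1 -[Y in _ = Y + _]h; ring.
rewrite -{1}sE [LHS]mxE mulr_sumr; apply: eq_bigr => j _.
by rewrite Xj [E^T _ _]mxE [E _ _]mxE rmorphXn /=; ring.
Qed.
End RankOne.

(** * Free additive convolution *)

Section Additive.
Context (R : realType).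
Implicit Types (mu : probability R R) (w z : R[i]).

Definition cauchy_transform mu w : R[i] := Cintegral mu setT (fun t : R => (w - t%:C)^-1).

Lemma cauchy_kernel_ge w (t : R) : 0 < CIm w -> CIm w <= normc (w - t%:C).
Proof.
move=> w0; apply: le_trans (normc_geIm _); rewrite !ReImE /= subr0.
exact: ler_norm.
Qed.

Lemma measurable_cauchy_kernelRe w : measurable_fun setT (fun t : R => CRe (w - t%:C)).
Proof. by under eq_fun do rewrite !ReImE /=; apply: measurable_funB. Qed.

Lemma measurable_cauchy_kernelIm w : measurable_fun setT (fun t : R => CIm (w - t%:C)).
Proof. by under eq_fun do rewrite !ReImE /=; apply: measurable_cst. Qed.

Lemma bounded_measurable_cauchy w : 0 < CIm w ->
  bounded_measurable setT (fun t : R => (w - t%:C)^-1).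
Proof.
move=> w0; apply: (bounded_measurableV w0) => [||t _]; last exact: cauchy_kernel_ge.
  exact: measurable_cauchy_kernelRe.
exact: measurable_cauchy_kernelIm.
Qed.

Lemma subrC_neq0 w (t : R) : 0 < CIm w -> w - t%:C != 0.
Proof. by move=> w0; rewrite -normc_gt0 (lt_le_trans w0)// cauchy_kernel_ge. Qed.

Lemma cauchy_kernelE w (t : R) : 0 < CIm w ->
  CRe ('i * (w - t%:C)^-1) + 0 = CIm w * normc (w - t%:C)^-1 ^+ 2.
Proof.
move=> w0; rewrite normcV exprVn sqr_normcE addr0 CReM CImV.
by rewrite mul0r sub0r mul1r mulNr opprK; congr (_ / _); rewrite !ReImE /= subr0.
Qed.

Lemma cauchy_im_lt0 mu w : 0 < CIm w -> CIm (cauchy_transform mu w) < 0.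
Proof.
move=> w0.
have : 0 < CRe ('i * cauchy_transform mu w) + 0.
  apply: Cintegral_affine_gt0 => //.
  - exact: probability_setT.
  - exact: bounded_measurable_cauchy.
  - by move=> t _; rewrite cauchy_kernelE// mulr_ge0 ?sqr_ge0// ltW.
  - rewrite (_ : [set _ | _] = set0) ?measure0//.
    apply/seteqP; split => // t [_] /=; rewrite cauchy_kernelE// => /eqP.
    by rewrite mulf_eq0 gt_eqF//= expf_eq0 /= gt_eqF// normc_gt0 invr_eq0 subrC_neq0.
by rewrite !ReImE /=; lra.
Qed.

Lemma cauchy_neq0 mu w : 0 < CIm w -> cauchy_transform mu w != 0.
Proof.
by move=> /(cauchy_im_lt0 mu) h; apply/eqP => e; rewrite e ltxx in h.
Qed.

Lemma F_transformE mu w : F_transform mu w = (cauchy_transform mu w)^-1.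
Proof. by []. Qed.

(** The imaginary part of the kernel [g] is [- Im w * |g|^2], so Jensen's inequality
    gives [- Im S >= Im w * |S|^2] for [S = 1 / F]. *)
Lemma F_transform_im mu w : 0 < CIm w -> CIm w <= CIm (F_transform mu w).
Proof.
move=> w0; rewrite F_transformE.
have : CIm w * normc (cauchy_transform mu w) ^+ 2 <= CRe ('i * cauchy_transform mu w) + 0.
  apply: Cintegral_sqr_le => //.
  - exact: probability_setT.
  - exact: bounded_measurable_cauchy.
  - exact: ltW.
  - by move=> t _; exact: cauchy_kernelE.
rewrite sqr_normcE !ReImE ler_pdivlMr /=; first by lra.
by rewrite ltr_wpDl ?sqr_ge0// exprn_even_gt0//= lt_eqF ?cauchy_im_lt0.
Qed.

Lemma cauchy_kernel_sep (a t : R) : [set: R] a -> [set: R] t -> a <> t ->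
  forall w : nat -> R[i],
  (w k - a%:C : Cplx R) @[k --> \oo] --> (0 : Cplx R) ->
  exists2 l : Cplx R, l != 0 & (w k - t%:C : Cplx R) @[k --> \oo] --> l.
Proof.
move=> _ _ at_ w wa; exists ((a - t)%:C : Cplx R).
  by apply/eqP => -[/eqP]; rewrite subr_eq0 => /eqP.
have -> : ((a - t)%:C : Cplx R) = 0 + ((a - t)%:C : Cplx R) by rewrite add0r.
have -> : (fun k => w k - t%:C : Cplx R) =
    (fun k => (w k - a%:C) + (a - t)%:C : Cplx R).
  by apply/funext => k; rewrite rmorphB /= addrA subrK.
exact: cvgD wa (cvg_cst _).
Qed.

Lemma F_transform_dirac mu (b : R) w : mass mu b = 1 -> 0 < CIm w ->
  F_transform mu w = w - b%:C.
Proof.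
move=> mb w0; rewrite F_transformE /cauchy_transform (@Cintegral_finite _ _ _ _ _ _ _ [:: b])//.
- by rewrite big_seq1 mb mul1r invrK.
- rewrite [X in mu X](_ : _ = [set b]); last exact: classical_sets.set_cons1.
  by rewrite -mass_EFin ?mb//.
- exact: bounded_measurable_cauchy.
Qed.

(** Along [z = c + i y], the relation [Z1 z + Z2 z - z = 1 / S] tends to
    [a + b - c = 0]; it then reads [(Z1 z - a) + (Z2 z - b) - (z - c) = 1 / S], and
    multiplication by [S] gives the relation between the masses. *)
Lemma free_add_atoms mu1 mu2 mu (c : R) : free_add mu1 mu2 mu -> 0 < mass mu c ->
  exists a b : R, a + b = c /\ mass mu1 a + mass mu2 b = mass mu c + 1.
Proof.
move=> [Z1 [Z2 [[nu1 Z1F] [nu2 Z2F] Z]]] mc0.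
pose y : nat -> R := harmonic.
pose z k : R[i] := c +i* y k.
have y0 k : 0 < y k by rewrite /y /= invr_gt0.
have yc : y @ \oo --> (0 : R) by exact: cvg_harmonic.
have zc k : normc (z k - c%:C) <= 1 * y k.
  rewrite (_ : z k - c%:C = 0 +i* y k) ?mul1r /=; last first.
    by apply: complex_eqP; rewrite !ReImE /=; ring.
  by rewrite expr0n add0r sqrtr_sqr ger0_norm// ltW.
have hw k : normc (cauchy_transform mu (z k))^-1 < 1 ->
    [/\ forall t : R, [set: R] t -> y k <= normc (Z1 (z k) - t%:C),
        forall t : R, [set: R] t -> y k <= normc (Z2 (z k) - t%:C),
        cauchy_transform mu1 (Z1 (z k)) = cauchy_transform mu (z k) &
        cauchy_transform mu2 (Z2 (z k)) = cauchy_transform mu (z k)].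
  move=> _; have uz : upper_half_plane (z k) by exact: y0.
  have [_ Z12 Z1z] := Z _ uz.
  have zk : 0 < CIm (z k) by exact: y0.
  have i1 : y k <= CIm (Z1 (z k)) by rewrite Z1F//; exact: (F_transform_im nu1 zk).
  have i2 : y k <= CIm (Z2 (z k)) by rewrite Z2F//; exact: (F_transform_im nu2 zk).
  split.
  - by move=> t _; rewrite (le_trans i1)// cauchy_kernel_ge// (lt_le_trans (y0 k)).
  - by move=> t _; rewrite (le_trans i2)// cauchy_kernel_ge// (lt_le_trans (y0 k)).
  - by apply: invr_inj; rewrite -!F_transformE Z1z.
  - by apply: invr_inj; rewrite -!F_transformE Z1z Z12.
have [a [b [phi _ [s0 [z0 w10 w20] hz h1 h2]]]] :=
  @subordination_at_atom _ R R setT measurableT (@measurable_set1 R)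
   (fun w (t : R) => w - t%:C) measurable_cauchy_kernelRe measurable_cauchy_kernelIm
   cauchy_kernel_sep mu mu1 mu2 z (fun k => Z1 (z k)) (fun k => Z2 (z k)) y 1 c
   (probability_setT mu1) (probability_setT mu2) I mc0 y0 yc
   (fun k x _ => cauchy_kernel_ge x (y0 k : 0 < CIm (z k))) zc hw.
have rel k : Z1 (z k) + Z2 (z k) - z k = (cauchy_transform mu (z k))^-1.
  have [Zz _ Z1z] := Z (z k) (y0 k).
  by rewrite {3}Zz -Z1z F_transformE; ring.
have abc : c%:C - a%:C - b%:C = 0 :> Cplx R.
  apply: (etrans (cvgC_cst_eq (x := c%:C - a%:C - b%:C) (cvgCB (cvgCB (cvgCD w10 w20) z0) s0) _)).
    by move=> k; rewrite [LHS]/= -[Cintegral _ _ _]/(cauchy_transform _ _) -rel; ring.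
  by rewrite !subr0 addr0.
exists a, b; split.
  by move/(congr1 (@CRe R)) : abc; rewrite !ReImE /=; lra.
have : (1 : Cplx R) = (mass mu1 a)%:C + (mass mu2 b)%:C - (mass mu c)%:C.
  apply: (cvgC_cst_eq (cvgCB (cvgCD h1 h2) hz)).
  move=> k; rewrite [LHS]/=; set w := phi k.
  rewrite -!/(cauchy_transform mu (z w)) -mulrDl -mulrBl.
  rewrite [X in X * _](_ : _ = (cauchy_transform mu (z w))^-1) ?mulVf//.
    by apply: cauchy_neq0; exact: y0.
  rewrite -rel; transitivity (Z1 (z w) + Z2 (z w) - z w + (c%:C - a%:C - b%:C)).
    by ring.
  by rewrite abc addr0.
by move/(congr1 (@CRe R)); rewrite !ReImE /=; lra.
Qed.
(** Up to the translation by [a], [nu] is the spectral measure of the rank-one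
    perturbation of the diagonal matrix of the atoms of [mu]: the identity
    [s = (1 + b s) g] says that [1 / s = 1 / g - b]. *)
Lemma F_transform_shift mu (s : seq R) (a b : R) : uniq s -> mu [set` s] = 1%E ->
  exists nu : probability R R, forall w, 0 < CIm w ->
    F_transform nu w = F_transform mu (w + a%:C) - b%:C.
Proof.
move=> us s1; pose n := size s.
pose t (j : 'I_n) := nth 0 s j - a.
pose e (j : 'I_n) := Num.sqrt (mass mu (nth 0 s j)).
have ee j : e j ^+ 2 = mass mu (nth 0 s j) by rewrite sqr_sqrtr// mass_ge0.
have e1 : \sum_j e j ^+ 2 = 1.
  transitivity (\sum_(x <- s) mass mu x).
    by rewrite (big_nth 0) big_mkord; apply: eq_bigr => j _; rewrite ee.
  by apply: (@EFin_inj R); rewrite sum_mass.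
have [p [l [p0 p1 pl]]] := rank_one_perturbation t b e1.
exists (discrete_probability l p0 p1) => w w0.
have wa0 : 0 < CIm (w + a%:C) by rewrite !ReImE /= addr0.
have nuE : cauchy_transform (discrete_probability l p0 p1) w =
    \sum_j (p j)%:C / (w - (l j)%:C).
  by rewrite /cauchy_transform Cintegral_discrete//; exact: bounded_measurable_cauchy.
have muE : cauchy_transform mu (w + a%:C) = \sum_j (e j ^+ 2)%:C / (w - (t j)%:C).
  rewrite /cauchy_transform (Cintegral_finite _ _ us)//; last exact: bounded_measurable_cauchy.
  rewrite (big_nth 0) big_mkord; apply: eq_bigr => j _; rewrite ee /t.
  by congr (_ / _); rewrite rmorphB /=; ring.
have := pl w w0; rewrite -nuE -muE !F_transformE => h.
have n0 := cauchy_neq0 (discrete_probability l p0 p1) w0.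
have m0 := cauchy_neq0 mu wa0.
have hG : (cauchy_transform mu (w + a%:C))^-1 * cauchy_transform (discrete_probability l p0 p1) w =
    1 + b%:C * cauchy_transform (discrete_probability l p0 p1) w.
  by rewrite {1}h mulrC mulfK.
by apply: (mulIf n0); rewrite mulVf// mulrBl hG; ring.
Qed.

(** Here [Z1 z = z - b], so [F_mu1 z = F_mu (z + b)].  The subordination functions
    of the new factorization are [z + b] and [F_mu (z + b) - b]; the second one is
    an F-transform by [F_transform_shift]. *)
Lemma free_add_dirac_r mu1 mu2 mu (s : seq R) (b : R) :
  uniq s -> mu [set` s] = 1%E -> free_add mu1 mu2 mu -> mass mu2 b = 1 ->
  free_add mu (\d_(- b) : probability R R) mu1.
Proof.
move=> us s1 [Z1 [Z2 [[nu1 Z1F] [nu2 Z2F] Z]]] mb.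
have [nu nuE] := F_transform_shift b b us s1.
have uzb z : 0 < CIm z -> 0 < CIm (z + b%:C) by move=> z0; rewrite !ReImE /= addr0.
have Fb z : 0 < CIm z -> F_transform mu1 z = F_transform mu (z + b%:C).
  move=> /uzb z0; have [Zz Z12 Z1z] := Z _ z0.
  have Z20 : 0 < CIm (Z2 (z + b%:C)).
    by rewrite Z2F// (lt_le_trans z0)//; exact: F_transform_im.
  rewrite Z1z; rewrite Z12 (F_transform_dirac mb)// in Zz.
  have /addIr e : z + b%:C = Z1 (z + b%:C) + b%:C by rewrite {1}Zz; ring.
  by rewrite -e.
exists (fun z => z + b%:C), (F_transform nu); split.
- exists (\d_(- b) : probability R R) => z z0.
  by rewrite (F_transform_dirac (mass_dirac _ _))// rmorphN opprK.
- by exists nu.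
- move=> z; rewrite /upper_half_plane /= => z0.
  have nu0 : 0 < CIm (F_transform nu z).
    exact: lt_le_trans z0 (F_transform_im _ z0).
  rewrite (F_transform_dirac (mass_dirac _ _))// nuE// rmorphN opprK subrK Fb//.
  by split=> //; ring.
Qed.

Lemma additive_indecomposable mu : ~ is_dirac setT mu -> finite_set (msupport mu) ->
  indecomposable setT (@free_add R) setT mu.
Proof.
move=> nd /finite_support_atoms_R[s [us s1 s0]]; split => // mu1 [_ [mu2 _ fa]].
have mp := @measurable_set1 R.
have ssum : \sum_(c <- s) mass mu c + 0 = 1 by rewrite addr0 sum_mass1.
have sp c : c \in s -> 0 < mass mu c by move=> /s0; rewrite -mass_EFin.
have [|[a _ a1]|[b _ b1]] := unit_weight_of_atom_sums us (seq_neq_nil s1) (lexx 0) (lexx 0)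
  (@mass_weights _ _ _ mp mu1 setT) (@mass_weights _ _ _ mp mu2 setT) ssum
  (or_introl (lexx 0)) sp (op := +%R).
- move=> c cs; have [a [b [ab h]]] := free_add_atoms fa (sp _ cs).
  by exists a, b.
- by left; exists a => //; exact: same_measure_dirac.
- by right; exists (- b) => //; exact: (free_add_dirac_r us s1 fa b1).
Qed.

End Additive.

(** * The multiplicative kernel *)

Section MulKernel.
Context (R : realType).

(** When [1 - w a] tends to 0, [w] tends to [1 / a] and [1 - w x] to [1 - x / a]. *)
Lemma mul_kernel_sep (a x : R[i]) : a <> x -> forall w : nat -> R[i],
  (1 - w k * a : Cplx R) @[k --> \oo] --> (0 : Cplx R) ->
  exists2 l : Cplx R, l != 0 & (1 - w k * x : Cplx R) @[k --> \oo] --> l.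
Proof.
move=> ax w wa; have [a0|a0] := eqVneq a 0.
  have /eqP : 1 = 0 :> Cplx R.
    by apply: (cvgC_cst_eq wa) => k; rewrite a0 mulr0 subr0.
  by rewrite oner_eq0.
exists (1 - x / a).
  by rewrite subr_eq0 eq_sym -(inj_eq (mulIf a0)) mulfVK// mul1r; apply/eqP => /esym.
have -> : (fun k => 1 - w k * x : Cplx R) =
    (fun k => (x / a) * (1 - w k * a) + (1 - x / a) : Cplx R).
  by apply/funext => k; field.
have := cvgCD (cvgCM (cvgCC (x / a)) wa) (cvgCC (1 - x / a)).
by rewrite mulr0 add0r.
Qed.

(** Write [z c = 1 - u], [w1 a = 1 - u1] and [w2 b = 1 - u2].  Once [a b = c] is
    known from the limit, the relation between [w1], [w2] and [z] reads
    [(1 - u1) (1 - u2) = (1 - u) (1 - 1 / s)].  Multiplied by [s], its first-order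
    terms tend to [m1 + m2 = m + 1]. *)
Lemma mul_atoms (w1 w2 z s : nat -> Cplx R) (a b c m1 m2 m : Cplx R) :
  (forall k, s k != 0) -> (forall k, w1 k * w2 k = z k * (1 - (s k)^-1)) ->
  ((s k)^-1 : Cplx R) @[k --> \oo] --> (0 : Cplx R) ->
  (1 - z k * c : Cplx R) @[k --> \oo] --> (0 : Cplx R) ->
  (1 - w1 k * a : Cplx R) @[k --> \oo] --> (0 : Cplx R) ->
  (1 - w2 k * b : Cplx R) @[k --> \oo] --> (0 : Cplx R) ->
  ((1 - z k * c) * s k : Cplx R) @[k --> \oo] --> m ->
  ((1 - w1 k * a) * s k : Cplx R) @[k --> \oo] --> m1 ->
  ((1 - w2 k * b) * s k : Cplx R) @[k --> \oo] --> m2 ->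
  a * b = c /\ m1 + m2 = m + 1.
Proof.
move=> s0 rel sV0 z0 w10 w20 hz h1 h2.
pose one : nat -> Cplx R := fun=> 1.
have h11 : one @ \oo --> (1 : Cplx R) := cvgCC 1.
have cc := @cvgCC R.
have abc : a * b = c.
  have L := cvgCB (cvgCM (cc (a * b)) (cvgCM (cvgCB h11 z0) (cvgCB h11 sV0)))
    (cvgCM (cc c) (cvgCM (cvgCB h11 w10) (cvgCB h11 w20))).
  have /esym/eqP : 0 = a * b * ((1 - 0) * (1 - 0)) - c * ((1 - 0) * (1 - 0)).
    apply: (cvgC_cst_eq L) => k; rewrite /one.
    transitivity (a * b * c * (z k * (1 - (s k)^-1) - w1 k * w2 k)); first by ring.
    by rewrite rel subrr mulr0.
  by rewrite !subr0 !mulr1 subr_eq0 => /eqP.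
split=> //.
have L := cvgCB (cvgCD h1 h2) (cvgCM w10 h2).
have L2 := cvgCB (cvgCD hz h11) z0.
have /esym/eqP : 0 = m1 + m2 - 0 * m2 - (m + 1 - 0).
  apply: (cvgC_cst_eq (cvgCB L L2)) => k; rewrite /one.
  transitivity (s k * (c * (z k * (1 - (s k)^-1)) - a * b * (w1 k * w2 k))).
    by field; exact: s0.
  by rewrite rel abc subrr mulr0.
by rewrite mul0r !subr0 subr_eq0 => /eqP.
Qed.

End MulKernel.

(** * Free multiplicative convolution on the half-line *)

Section MulPlus.
Context (R : realType).
Implicit Types (mu : probability R R) (w z : R[i]).

Let D : set R := [set x | 0 <= x].

Lemma measurable_Rplus : measurable D.
Proof.
rewrite (_ : D = `[0, +oo[%classic); first exact: measurable_itv.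
by apply/seteqP; split => x /=; rewrite in_itv /= andbT.
Qed.
Let mD := measurable_Rplus.

Definition one_psi_plus mu w : R[i] := Cintegral mu D (fun t : R => (1 - w * t%:C)^-1).

Lemma measurable_plus_kernelRe w : measurable_fun D (fun t : R => CRe (1 - w * t%:C)).
Proof.
under eq_fun do rewrite !ReImE /= mulr0 subr0.
by apply: measurable_funB => //; exact: measurable_funM.
Qed.

Lemma measurable_plus_kernelIm w : measurable_fun D (fun t : R => CIm (1 - w * t%:C)).
Proof.
under eq_fun do rewrite !ReImE /= mulr0 !add0r.
by apply: measurableT_comp => //; exact: measurable_funM.
Qed.

(** The distance from 1 to the line through 0 and [w] is [Im w / |w|]. *)
Lemma plus_kernel_ge w (t : R) : CIm w <= normc w * normc (1 - w * t%:C).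
Proof.
have -> : normc w = normc (conjc w) by case: (w) => a b /=; rewrite sqrrN.
rewrite -normcM; apply: le_trans (normc_geIm _).
rewrite (_ : CIm (conjc w * _) = - CIm w) ?normrN ?ler_norm//.
by case: (w) => a b; rewrite !ReImE /=; ring.
Qed.

Lemma Im_gt0_neq0 w : 0 < CIm w -> w != 0.
Proof. by move=> w0; apply/eqP => e; rewrite e ltxx in w0. Qed.

Lemma bounded_measurable_plus_kernel w : 0 < CIm w ->
  bounded_measurable D (fun t : R => (1 - w * t%:C)^-1).
Proof.
move=> w0; have nw : 0 < normc w by rewrite normc_gt0 Im_gt0_neq0.
apply: (bounded_measurableV (divr_gt0 w0 nw)) => [||t _].
- exact: measurable_plus_kernelRe.
- exact: measurable_plus_kernelIm.
- by rewrite ler_pdivrMr// mulrC; exact: plus_kernel_ge.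
Qed.

Lemma plus_kernel_neq0 w (t : R) : 0 < CIm w -> 1 - w * t%:C != 0.
Proof.
move=> w0; apply/eqP => e; have := plus_kernel_ge w t.
by rewrite e normc0 mulr0 leNgt w0.
Qed.

Lemma plus_kernelE w (t : R) : 0 < CIm w ->
  CRe (- 'i * w * (1 - w * t%:C)^-1) + 0 = CIm w * normc (1 - w * t%:C)^-1 ^+ 2.
Proof.
move=> w0; rewrite normcV exprVn sqr_normcE addr0 CReM CReV CImV mulrA mulrA -mulrBl.
by congr (_ / _); rewrite !ReImE /=; ring.
Qed.

Lemma plus_kernel_im w (t : R) : 0 < CIm w ->
  CRe (- 'i * (1 - w * t%:C)^-1) + 0 = CIm w * t * normc (1 - w * t%:C)^-1 ^+ 2.
Proof.
move=> w0; rewrite normcV exprVn sqr_normcE addr0 CReM CReV CImV mulrA mulrA -mulrBl.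
by congr (_ / _); rewrite !ReImE /=; ring.
Qed.

Section Transform.
Variable mu : probability R R.
Hypothesis muP : M_plus mu.
Let D1 : mu D = 1%E. Proof. by case: muP. Qed.

Lemma one_psi_plus_neq0 w : 0 < CIm w -> one_psi_plus mu w != 0.
Proof.
move=> w0; apply/eqP => e.
have : 0 < CRe (- 'i * w * one_psi_plus mu w) + 0.
  apply: Cintegral_affine_gt0 => //.
  - exact: bounded_measurable_plus_kernel.
  - by move=> t _; rewrite plus_kernelE// mulr_ge0 ?sqr_ge0// ltW.
  - rewrite (_ : [set _ | _] = set0) ?measure0//.
    apply/seteqP; split => // t [_] /=; rewrite plus_kernelE// => /eqP.
    by rewrite mulf_eq0 gt_eqF//= expf_eq0 /= gt_eqF// normc_gt0 invr_eq0 plus_kernel_neq0.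
by rewrite e mulr0 addr0 ltxx.
Qed.

Lemma psi_plusE w : 0 < CIm w -> psi_plus mu w = one_psi_plus mu w - 1.
Proof.
move=> w0; have -> : one_psi_plus mu w - 1 =
    Cintegral mu D (fun t : R => (1 - w * t%:C)^-1 + -1).
  rewrite CintegralD ?Cintegral_cst//; first exact: bounded_measurable_plus_kernel.
  exact: bounded_measurable_cst.
apply: eq_Cintegral => t _; have := plus_kernel_neq0 t w0.
by set e := 1 - _ => e0; apply: (mulIf e0); rewrite mulfVK// mulrDl mulVf// /e; ring.
Qed.

Lemma K_transformE w : 0 < CIm w -> K_transform mu w = 1 - (one_psi_plus mu w)^-1.
Proof.
move=> w0; rewrite /K_transform psi_plusE// addrCA subrr addr0 mulrBl divff ?mul1r//.
exact: one_psi_plus_neq0.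
Qed.

(** This is [arg (K w) >= arg w].  The kernel [g] satisfies
    [Im (w g) = Im w * |g|^2], so Jensen's inequality gives
    [Im (w S) >= Im w * |S|^2] for [K = 1 - 1 / S]. *)
Lemma K_transform_arg w : 0 < CIm w -> 0 <= CIm (conjc w * K_transform mu w).
Proof.
move=> w0; rewrite K_transformE//.
have : CIm w * normc (one_psi_plus mu w) ^+ 2 <= CRe (- 'i * w * one_psi_plus mu w) + 0.
  apply: Cintegral_sqr_le => //.
  - exact: bounded_measurable_plus_kernel.
  - exact: ltW.
  - by move=> t _; exact: plus_kernelE.
have n0 : 0 < normc (one_psi_plus mu w) ^+ 2 by rewrite exprn_gt0// normc_gt0 one_psi_plus_neq0.
rewrite -ler_pdivlMr// => h.
rewrite (_ : CIm (conjc w * _) = (CRe (- 'i * w * one_psi_plus mu w) + 0) /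
    normc (one_psi_plus mu w) ^+ 2 - CIm w).
  by rewrite subr_ge0.
move: n0; rewrite sqr_normcE; case: (one_psi_plus mu w) => a b; case: (w) => c d /= n0.
by field; rewrite gt_eqF.
Qed.

(** The kernel is real at [t = 0] only, which does not carry the whole mass. *)
Lemma K_transform_im w : 0 < CIm w -> 0 < CIm (K_transform mu w).
Proof.
move=> w0; rewrite K_transformE//.
have tz (t : R) : CIm w * t * normc (1 - w * t%:C)^-1 ^+ 2 = 0 -> t = 0.
  have n0 : 0 < normc (1 - w * t%:C)^-1 ^+ 2.
    by rewrite exprn_gt0// normc_gt0 invr_eq0 plus_kernel_neq0.
  by move/eqP; rewrite mulf_eq0 (gt_eqF n0) orbF mulf_eq0 (gt_eqF w0) => /eqP.
have : 0 < CRe (- 'i * one_psi_plus mu w) + 0.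
  apply: Cintegral_affine_gt0 => //.
  - exact: bounded_measurable_plus_kernel.
  - move=> t Dt; have t0 : 0 <= t := Dt.
    by rewrite plus_kernel_im// mulr_ge0 ?sqr_ge0// mulr_ge0// ltW.
  - case: muP => _; apply: le_lt_trans; apply: le_measure; rewrite ?inE.
    + rewrite (_ : [set _ | _] = D `&` [set 0]).
        by apply: measurableI => //; exact: measurable_set1.
      apply/seteqP; split => t [Dt] /=; rewrite plus_kernel_im//.
        by move=> /tz.
      by move=> t0; split => //; rewrite t0 mulr0 mul0r.
    + exact: measurable_set1.
    + by move=> t [Dt] /=; rewrite plus_kernel_im//; exact: tz.
have n0 : 0 < normc (one_psi_plus mu w) ^+ 2 by rewrite exprn_gt0// normc_gt0 one_psi_plus_neq0.
move=> h; rewrite CImD CImN CImV -sqr_normcE [CIm 1]/= add0r mulNr opprK.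
by rewrite divr_gt0//; move: h; rewrite !ReImE /=; lra.
Qed.

End Transform.

(** The integrand is real, whether or not the integral converges. *)
Lemma K_transform_real mu (r : R) : CIm (K_transform mu r%:C) = 0.
Proof.
have [p pE] : exists p : R, psi_plus mu r%:C = p%:C.
  exists (\int[mu]_(t in D) (r * t / (1 - r * t))).
  rewrite /psi_plus (_ : (fun xi : R => _) = fun t => (r * t / (1 - r * t))%:C).
    by rewrite /Cintegral /=; apply: complex_eqP => //=; rewrite Rintegral_cst// mul0r.
  by apply/funext => t; rewrite rmorphM fmorphV rmorphB rmorph1 rmorphM.
rewrite /K_transform pE (_ : p%:C / (1 + p%:C) = (p / (1 + p))%:C)//.
by rewrite rmorphM fmorphV rmorphD rmorph1.
Qed.

Lemma K_transform_dirac mu (b : R) w : M_plus mu -> mass mu b = 1 -> 0 <= b ->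
  0 < CIm w -> K_transform mu w = w * b%:C.
Proof.
move=> muP mb b0 w0; rewrite K_transformE//.
have -> : one_psi_plus mu w = (1 - w * b%:C)^-1.
  rewrite /one_psi_plus (@Cintegral_finite _ _ _ _ (@measurable_set1 R) _ _ [:: b])//.
  - by rewrite big_seq1 mb mul1r.
  - rewrite [X in mu X](_ : _ = [set b]); last exact: classical_sets.set_cons1.
    by rewrite -mass_EFin ?mb//.
  - by move=> a; rewrite inE => /eqP ->.
  - exact: bounded_measurable_plus_kernel.
by rewrite invrK; ring.
Qed.

End MulPlus.

Section MulPlusAtoms.
Context (R : realType).
Implicit Types (mu : probability R R) (w z : R[i]).
Local Notation D := ([set x | 0 <= x] : set R).
Let mD := @measurable_Rplus R.

Section Subordination.
Variables (mu1 mu2 mu : probability R R) (Z1 Z2 : Cplx R -> Cplx R).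
Hypotheses (mu1P : M_plus mu1) (mu2P : M_plus mu2) (muP : M_plus mu).
Hypothesis Z1ge0 : forall z, upper_half_plane z -> 0 <= CIm (Z1 z).
Hypothesis Z2ge0 : forall z, upper_half_plane z -> 0 <= CIm (Z2 z).
Hypothesis ZE : forall z, upper_half_plane z ->
  [/\ Z1 z * Z2 z = z * K_transform mu1 (Z1 z),
      K_transform mu1 (Z1 z) = K_transform mu2 (Z2 z) &
      K_transform mu z = K_transform mu1 (Z1 z)].

Lemma real_part_only w : CIm w = 0 -> w = (CRe w)%:C.
Proof. by move=> w0; apply: complex_eqP. Qed.

(** Class K only gives [Im (Z1 z) >= 0]; but a real value of [Z1] would make
    [K_mu z = K_mu1 (Z1 z)] real. *)
Lemma sub_plus_im1 z : 0 < CIm z -> 0 < CIm (Z1 z).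
Proof.
move=> z0; rewrite lt_neqAle (Z1ge0 z0) andbT; apply/eqP => /esym/real_part_only e.
have [_ _ h] := ZE z0; have := K_transform_im muP z0.
by rewrite h e K_transform_real ltxx.
Qed.

Lemma sub_plus_im2 z : 0 < CIm z -> 0 < CIm (Z2 z).
Proof.
move=> z0; rewrite lt_neqAle (Z2ge0 z0) andbT; apply/eqP => /esym/real_part_only e.
have [_ h2 h] := ZE z0; have := K_transform_im muP z0.
by rewrite h h2 e K_transform_real ltxx.
Qed.

(** From [u / z = k / v]: if [arg k >= arg v] then [arg u >= arg z]. *)
Lemma sub_plus_arg (u v z k : R[i]) : 0 < CIm v -> u * v = z * k ->
  0 <= CIm (conjc v * k) -> 0 <= CIm (u * conjc z).
Proof.
move=> v0 uv h; have v1 := Im_gt0_neq0 v0.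
have -> : u * conjc z = (normc z ^+ 2 / normc v ^+ 2)%:C * (conjc v * k).
  have nv : (normc v ^+ 2)%:C = v * conjc v.
    by rewrite sqr_normcE; case: (v) => a b; apply: complex_eqP; rewrite !ReImE /=; ring.
  have nz : (normc z ^+ 2)%:C = z * conjc z.
    by rewrite sqr_normcE; case: (z) => a b; apply: complex_eqP; rewrite !ReImE /=; ring.
  have e (x y : R) : (x / y)%:C = x%:C / y%:C :> R[i] by exact: fmorph_div.
  rewrite e nv nz; apply: (mulIf v1); rewrite mulrAC uv.
  have v2 : conjc v != 0 by rewrite conjc_eq0.
  transitivity (z * k * conjc z); first by ring.
  by field; rewrite v1 v2.
rewrite CImM /= mul0r addr0 mulr_ge0// divr_ge0 ?sqr_ge0//.
Qed.

Lemma sub_plus_arg1 z : 0 < CIm z -> 0 <= CIm (Z1 z * conjc z).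
Proof.
move=> z0; have [h1 h2 h3] := ZE z0; have Z20 := sub_plus_im2 z0.
apply: (sub_plus_arg Z20 h1); rewrite h2; exact: K_transform_arg.
Qed.

Lemma sub_plus_arg2 z : 0 < CIm z -> 0 <= CIm (Z2 z * conjc z).
Proof.
move=> z0; have [h1 h2 h3] := ZE z0; have Z10 := sub_plus_im1 z0.
apply: (sub_plus_arg (v := Z1 z) (k := K_transform mu1 (Z1 z))) => //.
  by rewrite mulrC.
exact: K_transform_arg.
Qed.

Lemma sub_plus_one_psi1 z : 0 < CIm z -> one_psi_plus mu1 (Z1 z) = one_psi_plus mu z.
Proof.
move=> z0; have [_ _] := ZE z0; rewrite !K_transformE//; last exact: sub_plus_im1.
by move/addrI/oppr_inj/invr_inj.
Qed.

Lemma sub_plus_one_psi2 z : 0 < CIm z -> one_psi_plus mu2 (Z2 z) = one_psi_plus mu z.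
Proof.
move=> z0; have [_ -> ] := ZE z0; rewrite !K_transformE//; last exact: sub_plus_im2.
by move/addrI/oppr_inj/invr_inj.
Qed.

Lemma sub_plus_prod z : 0 < CIm z -> Z1 z * Z2 z = z * (1 - (one_psi_plus mu z)^-1).
Proof. by move=> z0; have [-> _ <-] := ZE z0; rewrite K_transformE. Qed.

(** In the sector [Re w * h <= Im w] the ray from 0 through [w] keeps at distance at
    least [h / 2] from 1. *)
Lemma plus_kernel_sector (h : R) w (t : R) : 0 < h -> h <= 1 -> 0 < CIm w ->
  CRe w * h <= CIm w -> 0 <= t -> h / 2 <= normc (1 - w * t%:C).
Proof.
move=> h0 h1 w0 wh t0; have [wr|wr] := leP (CRe w) 0.
  apply: le_trans (normc_geRe _); rewrite !ReImE /= mulr0 subr0.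
  rewrite ger0_norm; have := mulr_le0_ge0 wr t0; lra.
have nw : 0 < normc w by rewrite normc_gt0 Im_gt0_neq0.
rewrite -(ler_pM2l nw); apply: le_trans (plus_kernel_ge w t).
have := normc_le_ReIm w; rewrite !gtr0_norm// => h3.
have : normc w * h <= (CRe w + CIm w) * h by rewrite ler_pM2r.
have : CIm w * h <= CIm w by rewrite ler_piMr// ltW.
by lra.
Qed.

(** For [z = (1 + i h) / c], the kernel [1 - z c = - i h] at the atom is comparable
    to the bound of [plus_kernel_sector].  The arguments of [Z1 z] and [Z2 z] are at least that
    of [z], so the same bound holds for them. *)
Lemma mul_plus_atoms (c : R) : 0 < c -> 0 < mass mu c ->
  exists a b : R, [/\ 0 <= a, 0 <= b, a * b = c & mass mu1 a + mass mu2 b = mass mu c + 1].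
Proof.
move=> c0 mc0.
pose h : nat -> R := harmonic.
have h0 k : 0 < h k by rewrite /h /= invr_gt0.
have h1 k : h k <= 1 by rewrite /h /= invf_le1// ler1n.
pose y k := h k / 2.
pose z k : R[i] := c^-1 +i* (h k / c).
have y0 k : 0 < y k by rewrite divr_gt0.
have yc : y @ \oo --> (0 : R).
  by rewrite -(mul0r 2^-1); apply: cvgMl; exact: cvg_harmonic.
have cc : c * c^-1 = 1 by rewrite divff// gt_eqF.
have zk k : 0 < CIm (z k) by rewrite /= divr_gt0.
have zc k : normc (1 - z k * c%:C) <= 2 * y k.
  rewrite (_ : 1 - z k * c%:C = 0 +i* (- h k)).
    by rewrite /= expr0n add0r sqrtr_sqr normrN gtr0_norm// /y; lra.
  by apply: complex_eqP; rewrite !ReImE /=; field; rewrite gt_eqF.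
have sector w k : 0 <= CIm (w * conjc (z k)) -> CRe w * h k <= CIm w.
  rewrite !ReImE /= => hh; rewrite -(@ler_pM2r _ c^-1) ?invr_gt0//.
  by move: hh; rewrite -mulrA; lra.
have yz k (t : R) : D t -> y k <= normc (1 - z k * t%:C).
  move=> t0; apply: plus_kernel_sector => //; apply: sector.
  by rewrite !ReImE /=; lra.
have hw k : normc (one_psi_plus mu (z k))^-1 < 1 ->
    [/\ forall t : R, D t -> y k <= normc (1 - Z1 (z k) * t%:C),
        forall t : R, D t -> y k <= normc (1 - Z2 (z k) * t%:C),
        one_psi_plus mu1 (Z1 (z k)) = one_psi_plus mu (z k) &
        one_psi_plus mu2 (Z2 (z k)) = one_psi_plus mu (z k)].
  move=> _; split.
  - move=> t t0; apply: plus_kernel_sector => //; first exact: sub_plus_im1.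
    by apply: sector; exact: sub_plus_arg1.
  - move=> t t0; apply: plus_kernel_sector => //; first exact: sub_plus_im2.
    by apply: sector; exact: sub_plus_arg2.
  - exact: sub_plus_one_psi1.
  - exact: sub_plus_one_psi2.
have sep (a x : R) : D a -> D x -> a <> x -> forall w : nat -> R[i],
    (1 - w k * a%:C : Cplx R) @[k --> \oo] --> (0 : Cplx R) ->
    exists2 l : Cplx R, l != 0 & (1 - w k * x%:C : Cplx R) @[k --> \oo] --> l.
  by move=> _ _ ax w; apply: mul_kernel_sep => -[].
have [a [b [phi [Da Db] [s0 [z0 w10 w20] hz h1' h2']]]] :=
  @subordination_at_atom _ R R D mD (@measurable_set1 R)
   (fun w (t : R) => 1 - w * t%:C) (@measurable_plus_kernelRe R) (@measurable_plus_kernelIm R)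
   sep mu mu1 mu2 z (fun k => Z1 (z k)) (fun k => Z2 (z k)) y 2 c
   (let: conj e _ := mu1P in e) (let: conj e _ := mu2P in e) (ltW c0) mc0 y0 yc yz zc hw.
have [abc mm] := @mul_atoms R (fun k => Z1 (z (phi k))) (fun k => Z2 (z (phi k)))
  (fun k => z (phi k)) (fun k => one_psi_plus mu (z (phi k))) a%:C b%:C c%:C
  (mass mu1 a)%:C (mass mu2 b)%:C (mass mu c)%:C
  (fun k => one_psi_plus_neq0 muP (zk _)) (fun k => sub_plus_prod (zk (phi k)))
  s0 z0 w10 w20 hz h1' h2'.
exists a, b; split => //.
  by move/(congr1 (@CRe R)) : abc; rewrite !ReImE /= mulr0 subr0.
by move/(congr1 (@CRe R)) : mm; rewrite !ReImE /=.
Qed.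

End Subordination.
End MulPlusAtoms.

Section MulPlusZero.
Context (R : realType).
Implicit Types (mu : probability R R) (w z : R[i]).
Local Notation D := ([set x | 0 <= x] : set R).
Let mD := @measurable_Rplus R.

(** At infinity the kernel tends to the indicator of 0, and in the left half-plane
    its modulus is at most 1. *)
Lemma one_psi_plus_limit_infty mu (w : nat -> R[i]) : (forall k, 0 < CIm (w k)) ->
  (forall k, CRe (w k) <= 0) -> ((w k)^-1 : Cplx R) @[k --> \oo] --> (0 : Cplx R) ->
  (one_psi_plus mu (w k) : Cplx R) @[k --> \oo] --> ((mass mu 0)%:C : Cplx R).
Proof.
move=> wi wr wc; rewrite -(Cintegral_indic mD (@measurable_set1 R) mu (lexx 0 : D 0)).
apply: (@Cintegral_cvg _ _ _ mu D mD (fun k (t : R) => (1 - w k * t%:C)^-1)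
  (fun t => (\1_[set 0] t)%:C) 1).
- by move=> k; exact: bounded_measurable_plus_kernel.
- exact: (bounded_measurable_indic R D (@measurable_set1 R)).
- move=> k t t0; rewrite normcV invf_le1.
    apply: le_trans (normc_geRe _); rewrite !ReImE /= mulr0 subr0.
    by rewrite ger0_norm; have := mulr_le0_ge0 (wr k) t0; lra.
  by rewrite normc_gt0 plus_kernel_neq0.
- move=> t t0; rewrite indicE; have [->|t1] := eqVneq t 0.
    have -> : (0 : R) \in [set (0 : R)] = true by rewrite mem_set.
    have -> : (fun k => (1 - w k * 0%:C)^-1) = (fun=> 1).
      by apply/funext => k; rewrite mulr0 subr0 invr1.
    exact: cvgCC.
  have -> : t \in [set (0 : R)] = false.
    by rewrite memNset// => /= e; rewrite e eqxx in t1.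
  have tC : 0 - t%:C != 0 :> Cplx R by rewrite sub0r oppr_eq0 eq_complex /= negb_and t1.
  have := cvgCM wc (cvgCV (cvgCB wc (cvgCC (t%:C))) tC); rewrite mul0r.
  have -> : (fun k => (w k)^-1 * ((w k)^-1 - t%:C)^-1) =
    (fun k => (1 - w k * t%:C)^-1).
    apply/funext => k; rewrite -invfM; congr (_^-1).
    by rewrite mulrBr mulfV// Im_gt0_neq0.
  exact: id.
Qed.

Variables (mu1 mu2 mu : probability R R) (Z1 Z2 : Cplx R -> Cplx R).
Hypotheses (mu1P : M_plus mu1) (mu2P : M_plus mu2) (muP : M_plus mu).
Hypothesis Z1ge0 : forall z, upper_half_plane z -> 0 <= CIm (Z1 z).
Hypothesis Z2ge0 : forall z, upper_half_plane z -> 0 <= CIm (Z2 z).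
Hypothesis ZE : forall z, upper_half_plane z ->
  [/\ Z1 z * Z2 z = z * K_transform mu1 (Z1 z),
      K_transform mu1 (Z1 z) = K_transform mu2 (Z2 z) &
      K_transform mu z = K_transform mu1 (Z1 z)].

Lemma mass0_lt1 : mass mu 0 < 1.
Proof. by case: muP => _; rewrite -(mass_EFin (@measurable_set1 R)) lte_fin. Qed.

(** Along [z = i k], [K_mu z] tends to [1 - 1 / mu {0}], which is not 0 as
    [mu {0} < 1], so [Z1 z * Z2 z = z * K_mu z] is unbounded.  Whichever of [Z1] and
    [Z2] has the larger modulus infinitely often tends to infinity along a
    subsequence, and [one_psi_plus_limit_infty] applies to its measure and to [mu]. *)
Lemma mul_plus_atom0 : 0 < mass mu 0 ->
  mass mu 0 = mass mu1 0 \/ mass mu 0 = mass mu2 0.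
Proof.
move=> m0; pose z k : R[i] := 0 +i* k.+1%:R.
have zk k : 0 < CIm (z k) by rewrite /= ltr0n.
have zV : ((z k)^-1 : Cplx R) @[k --> \oo] --> (0 : Cplx R).
  apply/cvgC0; rewrite (_ : (fun k => _) = harmonic); first exact: cvg_harmonic.
  apply/funext => k; rewrite normcV; congr (_^-1).
  by rewrite /= expr0n add0r sqrtr_sqr ger0_norm// ler0n.
have zlim : (one_psi_plus mu (z k) : Cplx R) @[k --> \oo] --> ((mass mu 0)%:C : Cplx R).
  exact: one_psi_plus_limit_infty.
have mC : (mass mu 0)%:C != 0 :> Cplx R by rewrite eq_complex /= gt_eqF.
have m1C : 1 - (mass mu 0)%:C^-1 != 0 :> Cplx R.
  rewrite subr_eq0 eq_sym -(inj_eq invr_inj) invrK invr1.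
  by rewrite eq_complex /= lt_eqF//; exact: mass0_lt1.
have prodV : ((Z1 (z k) * Z2 (z k))^-1 : Cplx R) @[k --> \oo] --> (0 : Cplx R).
  have := cvgCM zV (cvgCV (cvgCB (cvgCC 1) (cvgCV zlim mC)) m1C).
  rewrite mul0r (_ : (fun k => (z k)^-1 * _) = fun k => (Z1 (z k) * Z2 (z k))^-1)//.
  apply/funext => k; rewrite (sub_plus_prod muP ZE)// invfM//.
have side (nu : probability R R) (W W' : nat -> R[i]) :
    (forall k, 0 < CIm (W k)) -> (forall k, W' k != 0) ->
    (forall k, 0 <= CIm (W k * conjc (z k))) ->
    (forall k, one_psi_plus nu (W k) = one_psi_plus mu (z k)) ->
    ((W k * W' k)^-1 : Cplx R) @[k --> \oo] --> (0 : Cplx R) ->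
    (forall N, exists2 k, (N <= k)%N & normc (W' k) <= normc (W k)) ->
    mass mu 0 = mass nu 0.
  move=> Wi W'0 Wz We WV fr.
  have /choice[phi hphi] N : exists k, (N <= k)%N /\ normc (W' k) <= normc (W k).
    by have [k ? ?] := fr N; exists k.
  have phic := cvg_of_ge_id (fun k => proj1 (hphi k)).
  have WphiV : ((W (phi k))^-1 : Cplx R) @[k --> \oo] --> (0 : Cplx R).
    have /cvgC0/cvgrPdist_lt h := cvg_comp phi _ phic WV.
    apply/cvgC0/cvgrPdist_lt => e e0; have e2 : 0 < e ^+ 2 by rewrite exprn_gt0.
    apply: filterS (h _ e2) => k; rewrite !sub0r !normrN !ger0_norm ?normc_ge0//=.
    rewrite invfM normcM !normcV => hk.
    have n1 : 0 < normc (W' (phi k)) by rewrite normc_gt0.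
    have n2 : normc (W' (phi k)) <= normc (W (phi k)) := proj2 (hphi k).
    have n3 : (normc (W (phi k)))^-1 <= (normc (W' (phi k)))^-1.
      by rewrite lef_pV2 ?posrE// (lt_le_trans n1).
    have n4 : 0 <= (normc (W (phi k)))^-1 by rewrite invr_ge0 normc_ge0.
    rewrite -(@ltr_pXn2r _ 2)// ?nnegrE ?ltW//; apply: le_lt_trans hk.
    by rewrite expr2 ler_wpM2l.
  have lim1 : (one_psi_plus nu (W (phi k)) : Cplx R) @[k --> \oo] --> ((mass nu 0)%:C : Cplx R).
    apply: one_psi_plus_limit_infty => // k; have := Wz (phi k).
    rewrite !ReImE /= mulr0 addr0 mulrN oppr_ge0.
    by rewrite pmulr_lle0// ltr0n.
  have lim2 := cvg_comp phi _ phic zlim.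
  have : (mass mu 0)%:C = (mass nu 0)%:C :> Cplx R.
    apply: (cvg_unique (@norm_hausdorff _ (Cplx R)) lim2).
    by move: lim1; under eq_fun do rewrite We.
  by move/complexI.
have i1 k : 0 < CIm (Z1 (z k)) by exact: (sub_plus_im1 muP Z1ge0 ZE).
have i2 k : 0 < CIm (Z2 (z k)) by exact: (sub_plus_im2 muP Z2ge0 ZE).
have [fr|nfr] := pselect (forall N, exists2 k, (N <= k)%N &
    normc (Z2 (z k)) <= normc (Z1 (z k))).
  left; apply: (side mu1 (fun k => Z1 (z k)) (fun k => Z2 (z k))) => //.
  - by move=> k; exact: Im_gt0_neq0.
  - by move=> k; exact: (sub_plus_arg1 mu2P muP Z2ge0 ZE).
  - by move=> k; exact: (sub_plus_one_psi1 mu1P muP Z1ge0 ZE).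
right; apply: (side mu2 (fun k => Z2 (z k)) (fun k => Z1 (z k))).
- exact: i2.
- by move=> k; exact: Im_gt0_neq0.
- by move=> k; exact: (sub_plus_arg2 mu1P muP Z1ge0 ZE).
- by move=> k; exact: (sub_plus_one_psi2 mu2P muP Z2ge0 ZE).
- rewrite (_ : (fun k => (Z2 (z k) * Z1 (z k))^-1) = fun k => (Z1 (z k) * Z2 (z k))^-1).
    exact: prodV.
  by apply/funext => k; rewrite mulrC.
- move=> N; apply: contrapT => nN; apply: nfr => M.
  exists (maxn M N); first exact: leq_maxl.
  have [//|h] := leP (normc (Z2 (z (maxn M N)))) (normc (Z1 (z (maxn M N)))).
  by exfalso; apply: nN; exists (maxn M N); [exact: leq_maxr|exact: ltW].
Qed.

End MulPlusZero.

Section ScaleAnalytic.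
Context (R : realType).

Lemma derivable_scale (f : Cplx R -> Cplx R) (s t w : Cplx R) :
  derivable f (t * w) 1 -> derivable (fun z => s * f (t * z)) w 1.
Proof.
move=> /derivable1_diffP h; apply/derivable1_diffP.
have dt : differentiable (fun z : Cplx R => t * z) w.
  by apply/derivable1_diffP; apply: derivableM; [exact: derivable_cst|exact: derivable_id].
have ds : differentiable (fun z : Cplx R => s * z) (f (t * w)).
  by apply/derivable1_diffP; apply: derivableM; [exact: derivable_cst|exact: derivable_id].
exact: (differentiable_comp (differentiable_comp dt h) ds).
Qed.

Lemma near_scale (P : set (Cplx R)) (t z : Cplx R) :
  nbhs (t * z) P -> nbhs z (fun w => P (t * w)).
Proof.
move=> /nbhs_ballP[e /= e0 he]; apply/nbhs_ballP.
have t1 : 0 < 1 + `|t| :> R[i] by rewrite ltr_pwDl.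
exists (e / (1 + `|t|)); first exact: divr_gt0.
move=> w; rewrite -ball_normE /ball_ /= => zw; apply: he.
rewrite -ball_normE /ball_ /= -mulrBr normrM.
apply: le_lt_trans (_ : (1 + `|t|) * `|z - w| < e).
  by rewrite ler_wpM2r// lerDr.
by rewrite mulrC -ltr_pdivlMr.
Qed.

Lemma analytic_on_scale (A B : set (Cplx R)) (f : Cplx R -> Cplx R) (s t : Cplx R) :
  (forall z, A z -> B (t * z)) -> analytic_on B f ->
  analytic_on A (fun z => s * f (t * z)).
Proof.
move=> AB fB z /AB/fB h.
apply: filterS (near_scale h) => w; exact: derivable_scale.
Qed.

End ScaleAnalytic.

Section MulPlusMain.
Context (R : realType).
Implicit Types (mu : probability R R) (w z : R[i]).

Lemma scaleC_Re (s : R) z : CRe (s%:C * z) = s * CRe z.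
Proof. by rewrite CReM /= mul0r subr0. Qed.

Lemma scaleC_Im (s : R) z : CIm (s%:C * z) = s * CIm z.
Proof. by rewrite CImM /= mul0r addr0. Qed.

Lemma class_K_scale (f : Cplx R -> Cplx R) (s t : R) : 0 < s -> 0 < t ->
  class_K f -> class_K (fun z => s%:C * f (t%:C * z)).
Proof.
move=> s0 t0 [[f1 f2] f3 f4 f5].
have tup z : upper_half_plane z -> upper_half_plane (t%:C * z).
  by rewrite /upper_half_plane /= => z0; rewrite scaleC_Im mulr_gt0.
split.
- split; first exact: analytic_on_scale f1.
  by move=> z z0; rewrite scaleC_Im; apply: mulr_ge0; [exact: ltW|apply: f2; exact: tup].
- apply: analytic_on_scale f3 => z /= [x x0 <-]; exists (t * x); last by rewrite rmorphM.
  by rewrite /= pmulr_rlt0.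
- move=> x x0; have := f4 (t * x); rewrite pmulr_rlt0// rmorphM => /(_ x0).
  rewrite !lecE /= scaleC_Re scaleC_Im => /andP[/eqP <- h].
  by rewrite mulr0 eqxx /= mulr_ge0_le0// ltW.
- have -> : (fun x : R => s%:C * f (t%:C * (- x)%:C)) =
      (fun x => s%:C * f (- (t * x))%:C).
    by apply/funext => x; rewrite -rmorphM /= mulrN.
  apply/cvgC0/cvgrPdist_lt => e e0.
  move/cvgC0/cvgrPdist_lt : f5 => /(_ (e / s) (divr_gt0 e0 s0))[d /= d0 hd].
  exists (d / t) => /=; first by rewrite divr_gt0.
  move=> x /= xd x0; have := hd (t * x); rewrite /= !sub0r !normrN => h.
  have {}h : `|normc (f (- (t * x))%:C)| < e / s.
    apply: h; last by rewrite mulr_gt0.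
    by rewrite normrM (gtr0_norm t0) mulrC -ltr_pdivlMr//; move: xd; rewrite /ball /= sub0r normrN.
  by rewrite normcM normc_real (gtr0_norm s0) normrM (gtr0_norm s0) mulrC -ltr_pdivlMr.
Qed.

End MulPlusMain.

Section MulPlusIndecomposable.
Context (R : realType).
Implicit Types (mu : probability R R) (w z : R[i]).
Local Notation D := ([set x | 0 <= x] : set R).
Let mD := @measurable_Rplus R.
Let mp := @measurable_set1 R.

Lemma mass_dirac_neq (a b : R) : a != b -> mass (\d_a : probability R R) b = 0.
Proof.
move=> ab; rewrite /mass (_ : (\d_a : probability R R) [set b] = 0%E)//= diracE memNset//= => e.
by rewrite e eqxx in ab.
Qed.

Lemma class_K_id : class_K (id : Cplx R -> Cplx R).
Proof.
split.
- split; last by move=> z /ltW.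
  by move=> z _; apply: (@nearW _ (nbhs (z : Cplx R))) => w; exact: derivable_id.
- by move=> z _; apply: (@nearW _ (nbhs (z : Cplx R))) => w; exact: derivable_id.
- by move=> x x0; rewrite lecE /= eqxx ltW.
- apply: (@cvgC_real _ _ _ _ (fun x : R => - x) 0); rewrite -[X in _ --> X]oppr0; apply: cvgN.
  exact: (cvg_at_right_filter cvg_id).
Qed.

(** Here [K_mu = b Z2] and [Z1 z = b z], so [K_mu1 z = K_mu (z / b)].  The
    subordination functions of the new factorization are [z / b] and
    [b K_mu (z / b) = b^2 Z2 (z / b)]; the second one inherits its class from
    [Z2]. *)
Lemma free_mul_plus_dirac_r mu1 mu2 mu (b : R) : M_plus mu1 -> M_plus mu2 -> 0 < b ->
  free_mul_plus mu1 mu2 mu -> mass mu2 b = 1 ->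
  free_mul_plus mu (\d_(b^-1) : probability R R) mu1.
Proof.
move=> mu1P mu2P b0 [muP [Z1 [Z2 [[Z1K _] [Z2K _] ZE]]]] mb; split => //.
have Z1ge0 : forall z, upper_half_plane z -> 0 <= CIm (Z1 z) by case: Z1K => -[].
have Z2ge0 : forall z, upper_half_plane z -> 0 <= CIm (Z2 z) by case: Z2K => -[].
have bV0 : 0 < b^-1 by rewrite invr_gt0.
have bC : b%:C != 0 :> R[i] by rewrite eq_complex /= gt_eqF.
have Z1E z : 0 < CIm z -> Z1 z = b%:C * z /\ K_transform mu z = b%:C * Z2 z.
  move=> z0; have [h1 h2 h3] := ZE z z0.
  have Z20 := sub_plus_im2 muP Z2ge0 ZE z0.
  have K2 : K_transform mu2 (Z2 z) = Z2 z * b%:C.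
    by apply: K_transform_dirac => //; exact: ltW.
  split; last by rewrite h3 h2 K2 mulrC.
  apply: (mulIf (Im_gt0_neq0 Z20)); rewrite h1 h2 K2; ring.
have up z : 0 < CIm z -> 0 < CIm (b^-1%:C * z).
  by move=> z0; rewrite scaleC_Im mulr_gt0.
have bb : b%:C * b^-1%:C = 1 :> R[i] by rewrite -rmorphM /= divff// gt_eqF.
have Kb z : 0 < CIm z -> K_transform mu (b^-1%:C * z) = K_transform mu1 z.
  move=> z0; have [e1 _] := Z1E _ (up _ z0); have [_ _ ->] := ZE _ (up _ z0).
  by rewrite e1 mulrA bb mul1r.
have dP : M_plus (\d_(b^-1) : probability R R).
  split; first by rewrite /= diracE mem_set//= ltW.
  by rewrite -(mass_EFin mp) mass_dirac_neq ?lte_fin// gt_eqF.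
pose W1 z := b^-1%:C * (1%:C * z); pose W2 z := (b ^+ 2)%:C * Z2 (b^-1%:C * z).
have b20 : 0 < b ^+ 2 by rewrite exprn_gt0.
have W2up z : 0 < CIm z -> 0 < CIm (W2 z).
  move=> z0; rewrite scaleC_Im mulr_gt0//.
  exact: (sub_plus_im2 muP Z2ge0 ZE (up _ z0)).
have iup : upper_half_plane ('i : Cplx R) by rewrite /upper_half_plane /= ltr01.
exists W1, W2; split.
- split; first exact: class_K_scale class_K_id.
  by exists 'i => //; apply: Im_gt0_neq0; rewrite /W1 rmorph1 mul1r; exact: up.
- split; first exact: class_K_scale Z2K.
  by exists 'i => //; apply: Im_gt0_neq0; exact: W2up.
- move=> z z0; have zW1 : W1 z = b^-1%:C * z by rewrite /W1 rmorph1 mul1r.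
  have [_ KZ2] := Z1E _ (up _ z0).
  have dK : K_transform (\d_(b^-1) : probability R R) (W2 z) = W2 z * b^-1%:C.
    by apply: K_transform_dirac; [exact: dP|exact: mass_dirac|exact: ltW|exact: W2up].
  rewrite zW1 Kb// dK; split=> //.
  + rewrite -Kb// KZ2 /W2 rmorphXn /=.
    transitivity (b%:C * b^-1%:C * z * b%:C * Z2 (b^-1%:C * z)); first by ring.
    by rewrite bb; ring.
  + rewrite -Kb// KZ2 /W2 rmorphXn /=.
    transitivity (b%:C * b^-1%:C * b%:C * Z2 (b^-1%:C * z)); last by ring.
    by rewrite bb mul1r.
Qed.

Lemma mul_plus_indecomposable mu : M_plus mu ->
  ~ is_dirac [set a : R | 0 < a] mu -> finite_set (msupport mu) ->
  indecomposable (@M_plus R) (@free_mul_plus R) [set a : R | 0 < a] mu.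
Proof.
move=> muP nd /finite_support_atoms_R[s [us s1 s0]]; split => //.
move=> mu1 [mu1P [mu2 mu2P fm]].
have [_ [Z1 [Z2 [[Z1K _] [Z2K _] ZE]]]] := fm.
have Z1ge0 : forall z, upper_half_plane z -> 0 <= CIm (Z1 z) by case: Z1K => -[].
have Z2ge0 : forall z, upper_half_plane z -> 0 <= CIm (Z2 z) by case: Z2K => -[].
(* the atom at 0 plays the role of the extra mass of [unit_weight_of_atom_sums] *)
pose t := [seq c <- s | c != 0].
have ut : uniq t by rewrite filter_uniq.
have u0t : uniq (0 :: t) by rewrite /= mem_filter eqxx ut.
have ms (l : seq R) : measurable [set` l] := measurable_seq mp l.
have t1 : mu [set` 0 :: t] = 1%E.
  apply/eqP; rewrite eq_le probability_le1 ?ms//=.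
  rewrite -s1 le_measure ?inE ?ms// => x /= xs.
  by rewrite inE mem_filter xs andbT; case: eqP.
have sum1 : \sum_(c <- t) mass mu c + mass mu 0 = 1.
  by have := sum_mass1 mp u0t t1; rewrite big_cons addrC.
have tpos c : c \in t -> 0 < c.
  rewrite mem_filter => /andP[c0 /s0 mc]; rewrite lt_neqAle eq_sym c0 /= leNgt.
  apply/negP => cneg; have [D1 _] := muP.
  have : (mu [set c] <= mu (~` D))%E.
    rewrite le_measure ?inE//; first exact: measurableC.
    by move=> x /= ->; apply/negP; rewrite -ltNge.
  by rewrite probability_setC// D1 subee// leNgt mc.
have t0 : t != [::].
  apply/eqP => te; move: sum1; rewrite te big_nil add0r => m1.
  by have := mass0_lt1 muP; rewrite m1 ltxx.
have w (nu : probability R R) :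
    subprobability_weights (fun c : R => 0 < c) (mass nu) (mass nu 0).
  move=> l ul lP; have u0l : uniq (0 :: l).
    by rewrite /= ul andbT; apply/negP => /lP; rewrite ltxx.
  by have := sum_mass_le1 mp nu u0l; rewrite big_cons addrC.
have m0 : mass mu 0 <= mass mu1 0 \/ mass mu 0 <= mass mu2 0.
  have [h|h] := ltP 0 (mass mu 0); last by left; rewrite (le_trans h)// mass_ge0.
  by have [->|->] := mul_plus_atom0 mu1P mu2P muP Z1ge0 Z2ge0 ZE h; [left|right].
have [||[a a0 a1]|[b b0 b1]] := unit_weight_of_atom_sums ut t0
   (mass_ge0 mp mu1 0) (mass_ge0 mp mu2 0)
   (w mu1) (w mu2) sum1 m0 (op := *%R).
- by move=> c; rewrite mem_filter => /andP[_ /s0]; rewrite -(mass_EFin mp).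
- move=> c ct; have c0 := tpos _ ct.
  have mc : 0 < mass mu c.
    by move: ct; rewrite mem_filter => /andP[_ /s0]; rewrite -(mass_EFin mp).
  have [a [b [a0 b0 ab mm]]] := mul_plus_atoms mu1P mu2P muP Z1ge0 Z2ge0 ZE c0 mc.
  exists a, b; split => //.
    by rewrite lt_neqAle a0 andbT; apply/eqP => e; move: c0; rewrite -ab -e mul0r ltxx.
  by rewrite lt_neqAle b0 andbT; apply/eqP => e; move: c0; rewrite -ab -e mulr0 ltxx.
- by left; exists a => //; exact: same_measure_dirac.
- right; exists b^-1; first by rewrite /= invr_gt0.
  exact: free_mul_plus_dirac_r fm b1.
Qed.

End MulPlusIndecomposable.

(** * Free multiplicative convolution on the circle *)

Section Circle.
Context (R : realType).
Implicit Types (mu : probability (BorelC R) R) (w z : R[i]).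
Local Notation D := (@unit_circle R : set (BorelC R)).

Lemma unit_diskE z : unit_disk (z : Cplx R) = (normc z < 1).
Proof. by rewrite /unit_disk /= normr_normc -(rmorph1 (real_complex R)) ltcR. Qed.

Lemma unit_circleP z : unit_circle (z : Cplx R) <-> normc z = 1.
Proof.
rewrite /unit_circle /= normr_normc -(rmorph1 (real_complex R)).
by split => [/complexI|->].
Qed.

Lemma measurable_circle : measurable D.
Proof.
rewrite (_ : D = setT `&` (fun x : BorelC R => CRe x ^+ 2 + CIm x ^+ 2) @^-1` [set 1]).
  have mT := @measurableT _ (BorelC R).
  have mf : measurable_fun setT (fun x : BorelC R => CRe x ^+ 2 + CIm x ^+ 2).
    apply: measurable_funD; apply: measurable_funX.
      exact: measurable_CRe.
    exact: measurable_CIm.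
  by apply: mf => //; exact: measurable_set1.
rewrite setTI; apply/seteqP; split => x /=.
  by move/unit_circleP => x1; rewrite -sqr_normcE x1 expr1n.
rewrite -sqr_normcE => h; apply/unit_circleP/eqP.
by rewrite -(@eqrXn2 _ 2) ?normc_ge0 ?ler01 ?expr1n ?h.
Qed.
Let mD := measurable_circle.
Let mp := @BorelC_set1 R.

Definition one_psi_star mu w : R[i] :=
  Cintegral mu D (fun x : BorelC R => (1 - w * (x : Cplx R))^-1).

Lemma measurable_star_kernelRe w :
  measurable_fun D (fun x : BorelC R => CRe (1 - w * (x : Cplx R))).
Proof.
under eq_fun do rewrite CReD CReN CReM.
apply: measurable_funB => //; apply: measurable_funB; apply: measurable_funM => //.
  exact: measurable_CRe.
exact: measurable_CIm.
Qed.

Lemma measurable_star_kernelIm w :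
  measurable_fun D (fun x : BorelC R => CIm (1 - w * (x : Cplx R))).
Proof.
under eq_fun do rewrite CImD CImN CImM.
apply: measurable_funB => //; apply: measurable_funD; apply: measurable_funM => //.
  exact: measurable_CIm.
exact: measurable_CRe.
Qed.

Lemma star_kernel_ge w (x : R[i]) : normc x = 1 -> 1 - normc w <= normc (1 - w * x).
Proof.
move=> x1; have := @le_normcB R 1 (- (w * x)).
by rewrite normcN normcM x1 mulr1 normc1.
Qed.

Lemma bounded_measurable_star_kernel w : normc w < 1 ->
  bounded_measurable D (fun x : BorelC R => (1 - w * (x : Cplx R))^-1).
Proof.
rewrite -subr_gt0 => w1; apply: (bounded_measurableV w1).
- exact: measurable_star_kernelRe.
- exact: measurable_star_kernelIm.
- by move=> x /unit_circleP; exact: star_kernel_ge.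
Qed.

Lemma star_kernel_neq0 w (x : R[i]) : normc w < 1 -> normc x = 1 -> 1 - w * x != 0.
Proof.
by move=> w1 x1; rewrite -normc_gt0 (lt_le_trans _ (star_kernel_ge w x1))// subr_gt0.
Qed.

Lemma star_kernelE w (x : R[i]) : normc w < 1 -> normc x = 1 ->
  CRe (2%:C * (1 - w * x)^-1) + -1 = (1 - normc w ^+ 2) * normc (1 - w * x)^-1 ^+ 2.
Proof.
move=> w1 x1; have n0 : 0 < normc (1 - w * x) ^+ 2.
  by rewrite exprn_gt0// normc_gt0 star_kernel_neq0.
have wx : normc w ^+ 2 = normc (w * x) ^+ 2 by rewrite normcM x1 mulr1.
rewrite wx normcV exprVn scaleC_Re CReV -sqr_normcE.
apply: (mulIf (lt0r_neq0 n0)); rewrite mulrDl mulrA !mulfVK ?lt0r_neq0//.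
rewrite !sqr_normcE !ReImE /=; set a := CRe w * _ - _; set b := CRe w * _ + _; ring.
Qed.

Section Transform.
Variable mu : probability (BorelC R) R.
Hypothesis D1 : mu D = 1%E.

Lemma one_psi_star_Re_gt0 w : normc w < 1 -> 0 < CRe (one_psi_star mu w).
Proof.
move=> w1.
have : 0 <= CRe (2%:C * one_psi_star mu w) + -1.
  apply: Cintegral_affine_ge0 => //; first exact: bounded_measurable_star_kernel.
  move=> x /unit_circleP x1; rewrite star_kernelE// mulr_ge0 ?sqr_ge0//.
  by rewrite subr_ge0 exprn_ile1 ?normc_ge0// ltW.
by rewrite scaleC_Re; lra.
Qed.

Lemma one_psi_star_neq0 w : normc w < 1 -> one_psi_star mu w != 0.
Proof. by move=> /one_psi_star_Re_gt0 h; apply/eqP => e; rewrite e ltxx in h. Qed.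

Lemma psi_starE w : normc w < 1 -> psi_star mu w = one_psi_star mu w - 1.
Proof.
move=> w1; have -> : one_psi_star mu w - 1 =
    Cintegral mu D (fun x : BorelC R => (1 - w * (x : Cplx R))^-1 + -1).
  rewrite CintegralD ?Cintegral_cst//; first exact: bounded_measurable_star_kernel.
  exact: bounded_measurable_cst.
apply: eq_Cintegral => x /unit_circleP x1; have := star_kernel_neq0 w1 x1.
by set e := 1 - _ => e0; apply: (mulIf e0); rewrite mulfVK// mulrDl mulVf// /e; ring.
Qed.

Lemma Q_transformE w : normc w < 1 -> Q_transform mu w = 1 - (one_psi_star mu w)^-1.
Proof.
move=> w1; rewrite /Q_transform psi_starE// addrCA subrr addr0 mulrBl divff ?mul1r//.
exact: one_psi_star_neq0.
Qed.

(** Schwarz's lemma for [Q].  On the circle the kernel [g] satisfies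
    [2 Re g - 1 = (1 - |w|^2) |g|^2], so Jensen's inequality gives
    [|S - 1| <= |w| |S|] for [Q = 1 - 1 / S]. *)
Lemma Q_transform_le w : normc w < 1 -> normc (Q_transform mu w) <= normc w.
Proof.
move=> w1; have t0 := one_psi_star_neq0 w1.
have : (1 - normc w ^+ 2) * normc (one_psi_star mu w) ^+ 2 <= CRe (2%:C * one_psi_star mu w) + -1.
  apply: Cintegral_sqr_le => //; first exact: bounded_measurable_star_kernel.
    by rewrite subr_ge0 exprn_ile1 ?normc_ge0// ltW.
  by move=> x /unit_circleP x1; exact: star_kernelE.
rewrite scaleC_Re => h.
have -> : Q_transform mu w = (one_psi_star mu w - 1) / one_psi_star mu w.
  by rewrite Q_transformE// mulrBl divff// mul1r.
rewrite normcM normcV ler_pdivrMr ?normc_gt0//.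
rewrite -(@ler_pXn2r _ 2) ?nnegrE ?mulr_ge0 ?normc_ge0// exprMn.
by move: h; rewrite !sqr_normcE !ReImE /=; lra.
Qed.

Lemma Q_transform_dirac (b : R[i]) w : mass mu b = 1 -> normc b = 1 -> normc w < 1 ->
  Q_transform mu w = w * b.
Proof.
move=> mb b1 w1; rewrite Q_transformE//.
have -> : one_psi_star mu w = (1 - w * b)^-1.
  rewrite /one_psi_star (@Cintegral_finite _ _ _ _ mp _ mD [:: b])//.
  - by rewrite big_seq1 mb mul1r.
  - rewrite [X in mu X](_ : _ = [set b]); last exact: classical_sets.set_cons1.
    by rewrite -mass_EFin ?mb//.
  - by move=> a; rewrite inE => /eqP ->; apply/unit_circleP.
  - exact: bounded_measurable_star_kernel.
by rewrite invrK; ring.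
Qed.

End Transform.

Section Subordination.
Variables (mu1 mu2 mu : probability (BorelC R) R) (Z1 Z2 : Cplx R -> Cplx R).
Hypotheses (mu1D : mu1 D = 1%E) (mu2D : mu2 D = 1%E) (muD : mu D = 1%E).
Hypothesis Z1le1 : forall z, normc z < 1 -> normc (Z1 z) <= 1.
Hypothesis Z2le1 : forall z, normc z < 1 -> normc (Z2 z) <= 1.
Hypothesis ZE : forall z, normc z < 1 ->
  [/\ Z1 z * Z2 z = z * Q_transform mu1 (Z1 z),
      Q_transform mu1 (Z1 z) = Q_transform mu2 (Z2 z) &
      Q_transform mu z = Q_transform mu1 (Z1 z)].

(** When [w] lies on the unit circle [Q_nu w] is out of control, but then the bound
    reduces to [|Q_mu z| <= 1]. *)
Lemma sub_star_le_aux (nu : probability (BorelC R) R) z w : nu D = 1%E ->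
  normc z < 1 -> normc w <= 1 -> Q_transform mu z = Q_transform nu w ->
  normc (Q_transform mu z) <= normc w.
Proof.
move=> nuD z1; rewrite le_eqVlt => /predU1P[-> _|w1 ->].
  exact: le_trans (Q_transform_le muD z1) (ltW z1).
exact: Q_transform_le.
Qed.

(** [Z1 / z = Q_mu / Z2] has modulus at most 1. *)
Lemma sub_star_norm1 z : normc z < 1 -> Q_transform mu z != 0 ->
  normc (Z1 z) <= normc z.
Proof.
move=> z1 Q0; have [h1 h2 h3] := ZE z1.
have QZ : normc (Q_transform mu z) <= normc (Z2 z).
  by apply: (sub_star_le_aux mu2D) => //; [exact: Z2le1|rewrite h3].
have Z20 : 0 < normc (Z2 z) by rewrite (lt_le_trans _ QZ)// normc_gt0.
rewrite -(ler_pM2r Z20) -normcM h1 -h3 normcM ler_wpM2l ?normc_ge0//.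
Qed.

Lemma sub_star_norm2 z : normc z < 1 -> Q_transform mu z != 0 ->
  normc (Z2 z) <= normc z.
Proof.
move=> z1 Q0; have [h1 h2 h3] := ZE z1.
have QZ : normc (Q_transform mu z) <= normc (Z1 z).
  by apply: (sub_star_le_aux mu1D) => //; exact: Z1le1.
have Z10 : 0 < normc (Z1 z) by rewrite (lt_le_trans _ QZ)// normc_gt0.
rewrite -(ler_pM2l Z10) -normcM h1 -h3 normcM mulrC ler_wpM2r ?normc_ge0//.
Qed.

Lemma sub_star_prod z : normc z < 1 -> Z1 z * Z2 z = z * (1 - (one_psi_star mu z)^-1).
Proof. by move=> z1; have [-> _ <-] := ZE z1; rewrite Q_transformE. Qed.

(** Along the radius [z = (1 - y) / c], the kernel [1 - z c = y] is the distance from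
    [z] to the circle, and [Z1 z], [Z2 z] are at least as far from the circle. *)
Lemma mul_star_atoms (c : R[i]) : normc c = 1 -> 0 < mass mu c ->
  exists a b : R[i], [/\ normc a = 1, normc b = 1, a * b = c &
    mass mu1 a + mass mu2 b = mass mu c + 1].
Proof.
move=> c1 mc0; have c0 : c != 0 by rewrite -normc_gt0 c1.
pose y : nat -> R := harmonic.
have y0 k : 0 < y k by rewrite /y /= invr_gt0.
have y1 k : y k <= 1 by rewrite /y /= invf_le1// ler1n.
have yc : y @ \oo --> (0 : R) by exact: cvg_harmonic.
pose z k : R[i] := (1 - y k)%:C / c.
have zn k : normc (z k) = 1 - y k.
  by rewrite /z normcM normcV c1 invr1 mulr1 normc_real ger0_norm// subr_ge0.
have zlt k : normc (z k) < 1 by rewrite zn; have := y0 k; lra.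
have zc k : normc (1 - z k * c) <= 1 * y k.
  rewrite /z mulfVK// (_ : 1 - (1 - y k)%:C = (y k)%:C).
    by rewrite normc_real mul1r ger0_norm// ltW.
  by rewrite rmorphB rmorph1; ring.
have yz k (x : BorelC R) : D x -> y k <= normc (1 - z k * (x : Cplx R)).
  move=> /unit_circleP x1; apply: le_trans (star_kernel_ge _ x1).
  by rewrite zn; lra.
have near1 w k : normc w <= normc (z k) ->
    forall x : BorelC R, D x -> y k <= normc (1 - w * (x : Cplx R)).
  move=> wz x /unit_circleP x1; apply: le_trans (star_kernel_ge _ x1).
  by move: wz; rewrite zn; lra.
have hw k : normc (one_psi_star mu (z k))^-1 < 1 ->
    [/\ forall x : BorelC R, D x -> y k <= normc (1 - Z1 (z k) * (x : Cplx R)),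
        forall x : BorelC R, D x -> y k <= normc (1 - Z2 (z k) * (x : Cplx R)),
        one_psi_star mu1 (Z1 (z k)) = one_psi_star mu (z k) &
        one_psi_star mu2 (Z2 (z k)) = one_psi_star mu (z k)].
  move=> hs; have Q0 : Q_transform mu (z k) != 0.
    rewrite Q_transformE// subr_eq0; apply/eqP => e; move: hs.
    by rewrite -e normc1 ltxx.
  have n1 := sub_star_norm1 (zlt k) Q0; have n2 := sub_star_norm2 (zlt k) Q0.
  have m1 := le_lt_trans n1 (zlt k); have m2 := le_lt_trans n2 (zlt k).
  have [_ h2 h3] := ZE (zlt k).
  split; [exact: near1|exact: near1| |].
  - by move: h3; rewrite !Q_transformE// => /addrI/oppr_inj/invr_inj.
  - by move: h3; rewrite h2 !Q_transformE// => /addrI/oppr_inj/invr_inj.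
have sep (a x : BorelC R) : D a -> D x -> a <> x -> forall w : nat -> R[i],
    (1 - w k * (a : Cplx R) : Cplx R) @[k --> \oo] --> (0 : Cplx R) ->
    exists2 l : Cplx R, l != 0 & (1 - w k * (x : Cplx R) : Cplx R) @[k --> \oo] --> l.
  by move=> _ _ ax w; exact: mul_kernel_sep.
have Dc : D c by apply/unit_circleP.
have [a [b [phi [Da Db] [s0 [z0 w10 w20] hz h1 h2]]]] :=
  @subordination_at_atom _ (BorelC R) R D mD mp
   (fun w (x : BorelC R) => 1 - w * (x : Cplx R)) measurable_star_kernelRe measurable_star_kernelIm
   sep mu mu1 mu2 z (fun k => Z1 (z k)) (fun k => Z2 (z k)) y 1 c
   mu1D mu2D Dc mc0 y0 yc yz zc hw.
have [abc mm] := @mul_atoms R (fun k => Z1 (z (phi k))) (fun k => Z2 (z (phi k)))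
  (fun k => z (phi k)) (fun k => one_psi_star mu (z (phi k))) a b c
  (mass mu1 a)%:C (mass mu2 b)%:C (mass mu c)%:C
  (fun k => one_psi_star_neq0 muD (zlt _)) (fun k => sub_star_prod (zlt (phi k)))
  s0 z0 w10 w20 hz h1 h2.
exists a, b; split => //; [exact/unit_circleP|exact/unit_circleP|].
by move/(congr1 (@CRe R)) : mm; rewrite !ReImE /=.
Qed.

End Subordination.
End Circle.

Section CircleZeros.
Context (R : realType).
Implicit Types (mu : probability (BorelC R) R) (w z : R[i]).
Local Notation D := (@unit_circle R : set (BorelC R)).
Let mD := @measurable_circle R.
Let mp := @BorelC_set1 R.

(** The radius contains more points than [p] has roots. *)
Lemma poly_nonroot_near (p : {poly R[i]}) (z : R[i]) (e : R) : p != 0 -> z != 0 ->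
  0 < e -> exists t : R, [/\ 1 - e < t, t < 1 & ~~ root p (t%:C * z)].
Proof.
move=> p0 z0 e0; apply: contrapT => h.
pose t (i : nat) : R := 1 - e / i.+2%:R.
have t1 i : 1 - e < t i.
  by rewrite /t ltrD2l ltrN2 ltr_pdivrMr ?ltr0n// ltr_pMr// ltr1n.
have t2 i : t i < 1 by rewrite /t gtrBl divr_gt0// ltr0n.
pose rs := [seq (t i)%:C * z | i <- iota 0 (size p)].
have rootp : all (root p) rs.
  apply/allP => x /mapP[i _ ->]; apply: contrapT => /negP nr; apply: h.
  by exists (t i).
have urs : uniq rs.
  rewrite map_inj_uniq ?iota_uniq// => i j /(mulIf z0)/complexI.
  move=> /addrI/oppr_inj/(mulfI (lt0r_neq0 e0))/invr_inj/eqP.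
  by rewrite eqr_nat => /eqP[].
by have := max_poly_roots p0 rootp urs; rewrite size_map size_iota ltnn.
Qed.

Variables (mu : probability (BorelC R) R) (s : seq (BorelC R)).
Hypotheses (us : uniq s) (s1 : mu [set` s] = 1%E) (muP : M_star mu).
Hypothesis sD : forall c, c \in s -> D c.
Let D1 : mu D = 1%E. Proof. by case: muP. Qed.

(** [z * numer] is the numerator of the rational function [psi_mu]; its value at 0 is
    the mean of [mu]. *)
Let numer : {poly R[i]} := \sum_(c <- s) ((mass mu c)%:C * (c : R[i]))%:P *
  \prod_(c' <- s | c' != c) (1 - (c' : R[i]) *: 'X).

Let bounded_measurable_id : bounded_measurable D (fun x : BorelC R => (x : R[i])).
Proof.
split; [exact: measurable_CRe|exact: measurable_CIm|].
by exists 1 => x /unit_circleP ->.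
Qed.

Lemma numer_neq0 : numer != 0.
Proof.
case: muP => _; rewrite (Cintegral_finite mp mD us s1 sD bounded_measurable_id) => h.
apply/eqP => n0; move/eqP: h; apply.
transitivity (numer.[0]); last by rewrite n0 horner0.
rewrite /numer horner_sum; apply: eq_bigr => c _.
rewrite hornerM hornerC horner_prod big1 ?mulr1// => c' _.
by rewrite !hornerE; ring.
Qed.

Lemma psi_star_numer w : normc w < 1 ->
  (one_psi_star mu w - 1) * \prod_(c <- s) (1 - (c : R[i]) * w) = w * numer.[w].
Proof.
move=> w1; have c1 (c : BorelC R) : c \in s -> 1 - w * (c : R[i]) != 0.
  by move=> /sD /unit_circleP; exact: star_kernel_neq0.
have -> : one_psi_star mu w - 1 =
    \sum_(c <- s) (mass mu c)%:C * ((1 - w * (c : R[i]))^-1 - 1).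
  rewrite /one_psi_star (Cintegral_finite mp mD us s1 sD (bounded_measurable_star_kernel w1)).
  under [RHS]eq_bigr do rewrite mulrBr mulr1.
  by rewrite sumrB -(rmorph_sum (real_complex R)) sum_mass1.
rewrite mulr_suml /numer horner_sum mulr_sumr; apply: eq_big_seq => c cs.
rewrite hornerM hornerC horner_prod (bigD1_seq c)//=.
under [in RHS]eq_bigr do rewrite !hornerE.
set P := \prod_(_ <- _ | _) _.
have := c1 _ cs => c0.
by field.
Qed.

(** The relation [Z1 z * Z2 z = z * Q_mu z] does not determine [Z1] where [Q_mu]
    vanishes; there it is recovered by continuity along the sequence [u]. *)
Lemma Q_transform_nonzero_near z : normc z < 1 -> z != 0 ->
  exists2 u : nat -> Cplx R, (u @ \oo --> (z : Cplx R)) &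
    forall k, normc (u k) < 1 /\ Q_transform mu (u k) != 0.
Proof.
move=> z1 z0.
have /choice[t ht] k : exists t : R, [/\ 1 - harmonic k < t, t < 1 & ~~ root numer (t%:C * z)].
  by apply: poly_nonroot_near => //; [exact: numer_neq0|rewrite /= invr_gt0].
have t0 k : 0 < t k.
  have [h _ _] := ht k; apply: le_lt_trans h; rewrite subr_ge0 /=.
  by rewrite invf_le1// ler1n.
exists (fun k => (t k)%:C * z).
  apply/cvgC_normc; apply: (@squeeze_cvgr _ _ _ _ (fun=> 0) harmonic).
  - apply: nearW => k; have [h1 h2 _] := ht k; rewrite normc_ge0 andTb.
    rewrite -{1}[z]mul1r -mulrBl normcM -(rmorph1 (real_complex R)) -rmorphB normc_real.
    rewrite ger0_norm ?subr_ge0 ?ltW//.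
    have : (1 - t k) * normc z <= (1 - t k) * 1 by rewrite ler_wpM2l ?subr_ge0 ?ltW.
    by move: h1; set h := harmonic k; lra.
  - exact: cvg_cst.
  - exact: cvg_harmonic.
move=> k; have [_ t1 nr] := ht k.
have u1 : normc ((t k)%:C * z) < 1.
  rewrite normcM normc_real gtr0_norm//.
  by apply: le_lt_trans z1; rewrite ler_piMl ?normc_ge0// ltW.
split => //; apply: contra nr => /eqP Q0; apply/rootP.
have tz0 : (t k)%:C * z != 0 by rewrite mulf_neq0// eq_complex /= gt_eqF.
apply: (mulfI tz0); rewrite mulr0 -psi_star_numer//.
move: Q0; rewrite Q_transformE// => /eqP; rewrite subr_eq0 => /eqP h.
by rewrite -[one_psi_star mu _]invrK -h invr1 subrr mul0r.
Qed.

End CircleZeros.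

Section CircleIndecomposable.
Context (R : realType).
Implicit Types (mu : probability (BorelC R) R) (w z : R[i]).
Local Notation D := (@unit_circle R : set (BorelC R)).
Let mD := @measurable_circle R.
Let mp := @BorelC_set1 R.

Lemma dnbhs_scale (P : set (Cplx R)) (t : Cplx R) : t != 0 ->
  dnbhs (0 : Cplx R) P -> dnbhs (0 : Cplx R) (fun h => P (t * h)).
Proof.
move=> t0 hP; have := @near_scale R (fun h => h != 0 -> P h) t 0.
rewrite mulr0 => /(_ hP); apply: (@filterS _ (nbhs (0 : Cplx R))) => h hh h0.
by apply: hh; rewrite mulf_neq0.
Qed.

Lemma derive_scale (f : Cplx R -> Cplx R) (s t a : Cplx R) : t != 0 ->
  derivable f (t * a) 1 ->
  'D_1 (fun z : Cplx R => s * f (t * z)) a = s * t * 'D_1 f (t * a).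
Proof.
move=> t0 df.
pose phi (h : Cplx R) : Cplx R := h^-1 * (f (h + t * a) - f (t * a)).
have phiD : phi h @[h --> dnbhs (0 : Cplx R)] --> 'D_1 f (t * a).
  have -> : phi = fun h => h^-1 *: (f (h *: (1 : Cplx R) + t * a) - f (t * a)).
    by apply/funext => h; rewrite /phi -[h *: 1]/(h * 1) mulr1.
  exact: df.
have phitD : phi (t * h) @[h --> dnbhs (0 : Cplx R)] --> 'D_1 f (t * a).
  by move=> P nP; have := @dnbhs_scale (fun h => P (phi h)) t t0 (phiD P nP); exact: id.
apply: (cvg_lim (@norm_hausdorff _ (Cplx R))).
have -> : (fun h : Cplx R => h^-1 *: (s * f (t * (h *: (1 : Cplx R) + a)) - s * f (t * a))) =
    (fun h => s * t * phi (t * h)).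
  apply/funext => h; rewrite /phi -[h *: 1]/(h * 1) mulr1 invfM mulrDr.
  rewrite -[X in X = _]/(h^-1 * _).
  transitivity (s * (t * t^-1) * h^-1 * (f (t * h + t * a) - f (t * a))); last by ring.
  by rewrite divff//; ring.
have cs : (fun _ : Cplx R => s * t) @ dnbhs (0 : Cplx R) --> s * t by exact: cvg_cst.
exact: (cvgM cs phitD).
Qed.

Lemma analytic_derivable (A : set (Cplx R)) (f : Cplx R -> Cplx R) (z : Cplx R) :
  analytic_on A f -> A z -> derivable f z 1.
Proof.
move=> fA Az; have h := fA z Az.
by have := @nbhs_singleton (Cplx R) z (fun w => derivable f w 1) h.
Qed.

Lemma class_S_star_scale (f : Cplx R -> Cplx R) (s t : Cplx R) :
  normc s = 1 -> normc t = 1 -> class_S_star f -> class_S_star (fun z => s * f (t * z)).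
Proof.
move=> s1 t1 [f1 f2 f3 f4].
have s0 : s != 0 by rewrite -normc_gt0 s1.
have t0 : t != 0 by rewrite -normc_gt0 t1.
have td z : unit_disk z -> unit_disk (t * z).
  by rewrite !unit_diskE normcM t1 mul1r.
have d0 : derivable f 0 1.
  have u0 : unit_disk (0 : Cplx R) by rewrite unit_diskE normc0 ltr01.
  exact: (analytic_derivable f1 u0).
split.
- exact: analytic_on_scale f1.
- by move=> z /td /f2; rewrite !normr_normc normcM s1 mul1r.
- by rewrite mulr0 f3 mulr0.
- by rewrite derive_scale ?mulr0// !mulf_neq0.
Qed.

Lemma class_S_star_id : class_S_star (id : Cplx R -> Cplx R).
Proof.
split => //.
- by move=> z _; apply: (@nearW _ (nbhs (z : Cplx R))) => w; exact: derivable_id.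
- by move=> z /ltW.
- by rewrite derive_id oner_eq0.
Qed.

(** Where [Q_mu] does not vanish, [Q_mu = b Z2] and [Z1 z = b z] as on the half-line.
    The latter extends to the zeros of [Q_mu] by continuity, and then forces [Z2] to
    vanish there.  The subordination functions of the new factorization are [z / b]
    and [b^2 Z2 (z / b)]. *)
Lemma free_mul_star_dirac_r mu1 mu2 mu (s : seq (BorelC R)) (b : R[i]) :
  M_star mu1 -> M_star mu2 -> uniq s -> mu [set` s] = 1%E ->
  (forall c, c \in s -> D c) -> normc b = 1 ->
  free_mul_star mu1 mu2 mu -> mass mu2 b = 1 ->
  free_mul_star mu (\d_(b^-1 : BorelC R) : probability (BorelC R) R) mu1.
Proof.
move=> mu1P mu2P us s1 sD b1 [muP [Z1 [Z2 [Z1S Z2S ZE0]]]] mb; split => //.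
have D1 : mu1 D = 1%E by case: mu1P.
have D2 : mu2 D = 1%E by case: mu2P.
have D0 : mu D = 1%E by case: muP.
have ZE z : normc z < 1 -> [/\ Z1 z * Z2 z = z * Q_transform mu1 (Z1 z),
      Q_transform mu1 (Z1 z) = Q_transform mu2 (Z2 z) &
      Q_transform mu z = Q_transform mu1 (Z1 z)].
  by move=> z1; apply: ZE0; rewrite unit_diskE.
have [Z1a Z1le Z10 _] := Z1S; have [_ Z2le Z20 _] := Z2S.
have le1 z : normc z < 1 -> normc (Z1 z) <= 1.
  by move=> z1; rewrite -lecR rmorph1 -normr_normc; apply: Z1le; rewrite unit_diskE.
have le2 z : normc z < 1 -> normc (Z2 z) <= 1.
  by move=> z1; rewrite -lecR rmorph1 -normr_normc; apply: Z2le; rewrite unit_diskE.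
have b0 : b != 0 by rewrite -normc_gt0 b1.
have bV1 : normc b^-1 = 1 by rewrite normcV b1 invr1.
have nzE z : normc z < 1 -> Q_transform mu z != 0 ->
    Z1 z = b * z /\ Q_transform mu z = b * Z2 z.
  move=> z1 Q0; have [h1 h2 h3] := ZE z z1.
  have n2 := le_lt_trans (sub_star_norm2 D1 D0 le1 ZE z1 Q0) z1.
  have QE : Q_transform mu z = b * Z2 z.
    by rewrite h3 h2 (Q_transform_dirac D2 mb b1 n2) mulrC.
  split=> //; have Z2n : Z2 z != 0.
    by apply/eqP => e; move: Q0; rewrite QE e mulr0 eqxx.
  by apply: (mulIf Z2n); rewrite h1 -h3 QE; ring.
have ZbE z : normc z < 1 -> Z1 z = b * z /\ Q_transform mu z = b * Z2 z.
  move=> z1; have [Q0|] := eqVneq (Q_transform mu z) 0; last exact: nzE.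
  have [->|z0] := eqVneq z 0.
    split; first by rewrite Z10 mulr0.
    have n0 : normc (0 : R[i]) < 1 by rewrite normc0 ltr01.
    rewrite Z20 mulr0; apply: eq0_normc; apply/eqP; rewrite eq_le normc_ge0 andbT.
    by rewrite -[leRHS](@normc0 R); exact: Q_transform_le.
  have [u uz hu] := Q_transform_nonzero_near us s1 muP sD z1 z0.
  have Z1c : Z1 @ (z : Cplx R) --> Z1 z.
    have dz : derivable Z1 z 1.
      by apply: (analytic_derivable Z1a); rewrite unit_diskE.
    by apply: differentiable_continuous; apply/derivable1_diffP.
  have e1 : Z1 z = b * z.
    have L := cvgCB (cvg_comp u Z1 uz Z1c) (cvgCM (cvgCC b) uz).
    have e0 : 0 = Z1 z - b * z.
      apply: (cvgC_cst_eq L) => k; have [u1 uQ] := hu k.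
      by have [e _] := nzE _ u1 uQ; rewrite /comp e subrr.
    by apply/eqP; rewrite -subr_eq0 -e0.
  split=> //; rewrite Q0.
  have [h1 h2 h3] := ZE z z1; move: h1; rewrite -h3 Q0 mulr0 e1 => /eqP.
  by rewrite !mulf_eq0 (negbTE b0) (negbTE z0) /= => /eqP ->; rewrite mulr0.
have disk z : normc z < 1 -> normc (b^-1 * z) < 1.
  by move=> z1; rewrite normcM bV1 mul1r.
have Kb z : normc z < 1 -> Q_transform mu (b^-1 * z) = Q_transform mu1 z.
  move=> z1; have [e1 _] := ZbE _ (disk _ z1); have [_ _ ->] := ZE _ (disk _ z1).
  by rewrite e1 mulrA mulfV// mul1r.
have dD : (\d_(b^-1 : BorelC R) : probability (BorelC R) R) D = 1%E.
  by rewrite /= diracE mem_set//; apply/unit_circleP.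
have b21 : normc (b ^+ 2) = 1 by rewrite expr2 normcM b1 mulr1.
pose W1 z : Cplx R := b^-1 * (1 * z); pose W2 z : Cplx R := b ^+ 2 * Z2 (b^-1 * z).
exists W1, W2; split.
- exact: (class_S_star_scale bV1 (@normc1 R) class_S_star_id).
- exact: (class_S_star_scale b21 bV1 Z2S).
- move=> z; rewrite unit_diskE => z1.
  have zW1 : W1 z = b^-1 * z by rewrite /W1 mul1r.
  have [_ KZ2] := ZbE _ (disk _ z1).
  have W2n : normc (W2 z) < 1.
    rewrite /W2 normcM expr2 normcM b1 !mul1r.
    have -> : normc (Z2 (b^-1 * z)) = normc (Q_transform mu (b^-1 * z)).
      by rewrite KZ2 normcM b1 mul1r.
    exact: le_lt_trans (Q_transform_le D0 (disk _ z1)) (disk _ z1).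
  have dK : Q_transform (\d_(b^-1 : BorelC R) : probability (BorelC R) R) (W2 z) = W2 z * b^-1.
    by apply: Q_transform_dirac => //; exact: mass_dirac.
  rewrite zW1 Kb// dK; split=> //.
  + by rewrite -Kb// KZ2 /W2; field.
  + by rewrite -Kb// KZ2 /W2; field.
Qed.

Lemma mul_star_indecomposable mu : M_star mu ->
  ~ is_dirac D mu -> finite_set (msupport (T := Cplx R) mu) ->
  indecomposable (@M_star R) (@free_mul_star R) D mu.
Proof.
move=> muP nd /finite_support_atoms_C[s [us s1 s0]]; split => //.
move=> mu1 [mu1P [mu2 mu2P fm]].
have [_ [Z1 [Z2 [Z1S Z2S ZE0]]]] := fm.
have D1 : mu1 D = 1%E by case: mu1P.
have D2 : mu2 D = 1%E by case: mu2P.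
have D0 : mu D = 1%E by case: muP.
have ZE z : normc z < 1 -> [/\ Z1 z * Z2 z = z * Q_transform mu1 (Z1 z),
      Q_transform mu1 (Z1 z) = Q_transform mu2 (Z2 z) &
      Q_transform mu z = Q_transform mu1 (Z1 z)].
  by move=> z1; apply: ZE0; rewrite unit_diskE.
have [_ Z1le _ _] := Z1S; have [_ Z2le _ _] := Z2S.
have le1 z : normc z < 1 -> normc (Z1 z) <= 1.
  by move=> z1; rewrite -lecR rmorph1 -normr_normc; apply: Z1le; rewrite unit_diskE.
have le2 z : normc z < 1 -> normc (Z2 z) <= 1.
  by move=> z1; rewrite -lecR rmorph1 -normr_normc; apply: Z2le; rewrite unit_diskE.
have sp c : c \in s -> 0 < mass mu c by move=> /s0; rewrite -(mass_EFin mp).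
have sD c : c \in s -> D c.
  move=> cs; apply: contrapT => nDc.
  have : (mu [set c] <= mu (~` D))%E.
    apply: le_measure; rewrite ?inE; [exact: mp|exact: measurableC|].
    by move=> x /= ->.
  by rewrite (probability_setC mu mD) D0 subee// leNgt s0.
have ssum : \sum_(c <- s) mass mu c + 0 = 1 by rewrite addr0 sum_mass1.
have [|[a Da a1]|[b Db b1]] := unit_weight_of_atom_sums us (seq_neq_nil s1) (lexx 0) (lexx 0)
  (@mass_weights _ _ _ mp mu1 D) (@mass_weights _ _ _ mp mu2 D) ssum
  (or_introl (lexx 0)) sp (op := fun x y : BorelC R => ((x : R[i]) * (y : R[i])) : BorelC R).
- move=> c cs; have c1 : normc (c : R[i]) = 1 by apply/unit_circleP; exact: sD.
  have [a [b [a1 b1 ab h]]] := mul_star_atoms D1 D2 D0 le1 le2 ZE c1 (sp _ cs).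
  by exists a, b; split => //; apply/unit_circleP.
- by left; exists a => //; exact: same_measure_dirac.
- right; exists ((b : R[i])^-1 : BorelC R).
    by apply/unit_circleP; rewrite normcV; move/unit_circleP: Db => ->; rewrite invr1.
  by apply: (free_mul_star_dirac_r mu1P mu2P us s1 sD) fm b1; apply/unit_circleP.
Qed.

End CircleIndecomposable.

(** * The three semigroups *)

Theorem theorem2p14 (R : realType) :
  [/\ forall mu : probability R R,
        ~ is_dirac setT mu ->
        finite_set (msupport mu) ->
        indecomposable setT (@free_add R) setT mu,
      forall mu : probability R R,
        M_plus mu ->
        ~ is_dirac [set a : R | 0 < a] mu ->
        finite_set (msupport mu) ->
        indecomposable (@M_plus R) (@free_mul_plus R) [set a : R | 0 < a] mu &
      forall mu : probability (BorelC R) R,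
        M_star mu ->
        ~ is_dirac (@unit_circle R : set (BorelC R)) mu ->
        finite_set (msupport (T := Cplx R) mu) ->
        indecomposable (@M_star R) (@free_mul_star R)
          (@unit_circle R : set (BorelC R)) mu].
Proof.
split.
- exact: additive_indecomposable.
- exact: mul_plus_indecomposable.
- exact: mul_star_indecomposable.
Qed.
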